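(* Let $M$ be a simple matroid none of whose connected components has rank $3$. Then $M$ is modular if and only if $M$ has an adjoint $adM$ with $adM\cong M$.
   Context: All matroids are finite and nonempty. $\mathcal{L}(M)$ denotes the lattice of flats of $M$. A matroid $M$ is modular if $r(X)+r(Y)=r(X\wedge Y)+r(X\vee Y)$ for all flats $X,Y$ of $M$ (meet and join in $\mathcal{L}(M)$). A matroid $N$ is an adjoint of $M$ if $r(N)=r(M)$ and there is an injective order-reversing map $\phi:\mathcal{L}(M)\to\mathcal{L}(N)$ sending the coatoms of $\mathcal{L}(M)$ (the hyperplanes of $M$) bijectively onto the atoms of $\mathcal{L}(N)$. *)

(* Defs.v *)
From HB Require Import structures.
From mathcomp Require Import all_boot all_order.

Set Implicit Arguments.
Unset Strict Implicit.
Unset Printing Implicit Defensive.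

Import Order.TTheory.

Record matroid (T : finType) := Matroid {
  indep : {set T} -> bool;
  ground_nonempty : 0 < #|T|;
  indep0 : indep set0;
  indepS : forall I J : {set T}, I \subset J -> indep J -> indep I;
  indep_aug : forall I J : {set T}, indep I -> indep J -> #|I| < #|J| ->
    exists2 x, x \in J :\: I & indep (x |: I)
}.

Section MatroidBasics.
Variables (T : finType) (M : matroid T).
Implicit Types (e f x : T) (C F I J X Y : {set T}).

Definition circuit C : bool := minset (fun X => ~~ indep M X) C.

Definition loop e : bool := circuit [set e].

Definition parallel e f : bool := (e != f) && circuit [set e; f].

Definition simple_matroid : Prop :=
  (forall e, ~~ loop e) /\ (forall e f, ~~ parallel e f).

Definition rk X : nat := \max_(I : {set T} | (I \subset X) && indep M I) #|I|.

Definition mrank : nat := rk [set: T].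

Definition cl X : {set T} := [set x | rk (x |: X) == rk X].

Definition is_flat F : bool := cl F == F.

Definition same_component e f : bool :=
  (e == f) || [exists C, [&& circuit C, e \in C & f \in C]].

(* [same_component] is an equivalence relation by the strong circuit elimination
   property, so these are its classes.  The rank of the component [M | C] is
   [rk M C]. *)
Definition components : {set {set T}} := equivalence_partition same_component [set: T].

Lemma rk_ge I X : I \subset X -> indep M I -> #|I| <= rk X.
Proof. by move=> sIX iI; apply: leq_bigmax_cond; rewrite sIX. Qed.

Lemma rk_basis X : exists I, [/\ I \subset X, indep M I & #|I| = rk X].
Proof.
have [|I /andP[sIX iI] eI] :=
  eq_bigmax_cond (fun I : {set T} => #|I|)
    (A := [pred I : {set T} | (I \subset X) && indep M I]).
  by apply/card_gt0P; exists set0; rewrite inE sub0set indep0.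
by exists I; split.
Qed.

Lemma rkS X Y : X \subset Y -> rk X <= rk Y.
Proof.
by move=> sXY; have [I [sIX iI <-]] := rk_basis X; rewrite rk_ge ?(subset_trans sIX).
Qed.

Lemma indep_extend I X : I \subset X -> indep M I ->
  exists J, [/\ I \subset J, J \subset X, indep M J & #|J| = rk X].
Proof.
move=> sIX iI; have [n le_n] := ubnP (rk X - #|I|).
elim: n => // n IHn in I sIX iI le_n *.
have [B [sBX iB eB]] := rk_basis X.
have [leIB|ltIB] := leqP (rk X) #|I|.
  by exists I; split=> //; apply/eqP; rewrite eqn_leq leIB rk_ge.
have [|x /setDP[xB xI] ixI] := indep_aug iI iB; first by rewrite eB.
have sxX : x |: I \subset X by rewrite subUset sub1set (subsetP sBX).
have [|J [sJ sJX iJ eJ]] := IHn (x |: I) sxX ixI.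
  by rewrite cardsU1 xI add1n subnS -ltnS (leq_trans _ le_n) // ltnS prednK ?subn_gt0.
by exists J; split=> //; apply: subset_trans sJ; rewrite subsetUr.
Qed.

Lemma sub_cl X : X \subset cl X.
Proof. by apply/subsetP=> x xX; rewrite inE (setUidPr _) // sub1set. Qed.

Lemma clS X Y : X \subset Y -> cl X \subset cl Y.
Proof.
move=> sXY; apply/subsetP=> x; rewrite !inE => /eqP rxX.
apply: contraT => rxY.
have [I [sIX iI eI]] := rk_basis X.
have [J [sIJ sJY iJ eJ]] := indep_extend (subset_trans sIX sXY) iI.
have [K [sJK sKY iK eK]] := indep_extend (subset_trans sJY (subsetUr [set x] Y)) iJ.
have ltJK : #|J| < #|K| by rewrite eJ eK ltn_neqAle eq_sym rxY rkS ?subsetUr.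
have xK : x \in K.
  apply: contraLR ltJK => xK; rewrite -leqNgt eJ rk_ge //.
  apply/subsetP=> y yK; have := subsetP sKY y yK.
  by rewrite !inE; case: eqP => // yx; rewrite -yx yK in xK.
have xnY : x \notin Y.
  by apply: contra rxY => xY; rewrite (setUidPr _) // sub1set.
have ixI : indep M (x |: I).
  by apply: indepS iK; rewrite subUset sub1set xK (subset_trans sIJ).
have := rk_ge (setUS [set x] sIX) ixI.
by rewrite cardsU1 rxX -eI (contra (subsetP (subset_trans sIX sXY) x)) //= ltnn.
Qed.

Lemma rk_cl X : rk (cl X) = rk X.
Proof.
apply/eqP; rewrite eqn_leq [rk X <= _]rkS ?sub_cl // andbT leqNgt; apply/negP => lt.
have [I [sIX iI eI]] := rk_basis X.
have [J [sJX iJ eJ]] := rk_basis (cl X).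
have [|x /setDP[xJ xI] ixI] := indep_aug iI iJ; first by rewrite eI eJ.
have := subsetP sJX x xJ; rewrite inE => /eqP rxX.
by have := rk_ge (setUS [set x] sIX) ixI; rewrite cardsU1 rxX -eI xI ltnn.
Qed.

Lemma cl_flat X : is_flat (cl X).
Proof.
rewrite /is_flat eqEsubset sub_cl andbT; apply/subsetP=> x.
rewrite !inE rk_cl => /eqP rx.
by rewrite eqn_leq -{1}rx !rkS ?subsetUr ?setUS ?sub_cl.
Qed.

Lemma setT_flat : is_flat [set: T].
Proof. by rewrite /is_flat eqEsubset subsetT sub_cl. Qed.

Lemma setI_flat X Y : is_flat X -> is_flat Y -> is_flat (X :&: Y).
Proof.
move=> /eqP fX /eqP fY; rewrite /is_flat eqEsubset sub_cl andbT subsetI.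
by rewrite -{2}fX -{3}fY !clS ?subsetIl ?subsetIr.
Qed.

Lemma cl_sub X Y : is_flat Y -> (cl X \subset Y) = (X \subset Y).
Proof.
move=> /eqP fY; apply/idP/idP=> [|sXY]; first exact: subset_trans (sub_cl X).
by rewrite -fY clS.
Qed.

End MatroidBasics.

Record flat (T : finType) (M : matroid T) :=
  Flat { flat_set :> {set T}; flatP : is_flat M flat_set }.

Fact flat_display : Order.disp_t. Proof. exact: Order.Disp tt tt. Qed.

Section FlatLattice.
Variables (T : finType) (M : matroid T).
Implicit Types X Y Z : flat M.

HB.instance Definition _ := [isSub for @flat_set T M].
HB.instance Definition _ := [Finite of flat M by <:].

Definition flat_le X Y : bool := flat_set X \subset flat_set Y.

Fact flat_le_refl : reflexive flat_le. Proof. by move=> X; apply: subxx. Qed.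

Fact flat_le_anti : antisymmetric flat_le.
Proof. by move=> X Y sXY; apply/val_inj/eqP; rewrite eqEsubset. Qed.

Fact flat_le_trans : transitive flat_le.
Proof. by move=> Y X Z; apply: subset_trans. Qed.

HB.instance Definition _ := @Order.Le_isPOrder.Build flat_display (flat M)
  flat_le flat_le_refl flat_le_anti flat_le_trans.

Definition flat_meet X Y : flat M := Flat (setI_flat (flatP X) (flatP Y)).
Definition flat_join X Y : flat M :=
  Flat (cl_flat M (flat_set X :|: flat_set Y)).

Fact flat_meetP X Y Z :
  (X <= flat_meet Y Z)%O = (X <= Y)%O && (X <= Z)%O.
Proof. exact: subsetI. Qed.

Fact flat_joinP X Y Z :
  (flat_join X Y <= Z)%O = (X <= Z)%O && (Y <= Z)%O.
Proof.
by rewrite /Order.le /= /flat_le /= cl_sub ?subUset ?(flatP Z).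
Qed.

HB.instance Definition _ :=
  @Order.POrder_MeetJoin_isLattice.Build flat_display (flat M)
    flat_meet flat_join flat_meetP flat_joinP.

Definition flat_bot : flat M := Flat (cl_flat M set0).
Definition flat_top : flat M := Flat (setT_flat M).

Fact flat_le0x X : (flat_bot <= X)%O.
Proof. by rewrite /Order.le /= /flat_le /= cl_sub ?sub0set ?(flatP X). Qed.

Fact flat_lex1 X : (X <= flat_top)%O.
Proof. exact: subsetT. Qed.

HB.instance Definition _ :=
  @Order.hasBottom.Build flat_display (flat M) flat_bot flat_le0x.
HB.instance Definition _ :=
  @Order.hasTop.Build flat_display (flat M) flat_top flat_lex1.

Lemma flat_leE X Y : (X <= Y)%O = (flat_set X \subset flat_set Y).
Proof. by []. Qed.

Lemma flat_meetE X Y : (X `&` Y)%O = flat_set X :&: flat_set Y :> {set T}.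
Proof. by []. Qed.

Lemma flat_joinE X Y : (X `|` Y)%O = cl M (flat_set X :|: flat_set Y) :> {set T}.
Proof. by []. Qed.

Lemma flat_botE : (\bot%O : flat M) = cl M set0 :> {set T}.
Proof. by []. Qed.

Lemma flat_topE : (\top%O : flat M) = [set: T] :> {set T}.
Proof. by []. Qed.

End FlatLattice.

Section Atoms.
Variables (d : Order.disp_t) (L : finTBLatticeType d).
Implicit Types x y z : L.

Definition covers x y : bool := (x < y)%O && [forall z, ~~ ((x < z)%O && (z < y)%O)].

Definition atoms : {set L} := [set x | covers \bot%O x].
Definition coatoms : {set L} := [set x | covers x \top%O].

End Atoms.

Definition modular (T : finType) (M : matroid T) : Prop :=
  forall X Y : flat M,
    rk M X + rk M Y = rk M (X `&` Y)%O + rk M (X `|` Y)%O.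

Definition is_adjoint (S T : finType) (N : matroid S) (M : matroid T) : Prop :=
  mrank N = mrank M /\
  exists phi : flat M -> flat N,
    [/\ injective phi,
        forall X Y : flat M, (X <= Y)%O -> (phi Y <= phi X)%O
      & phi @: coatoms (flat M) = atoms (flat N)].

Definition isomorphic (S T : finType) (N : matroid S) (M : matroid T) : Prop :=
  exists2 f : S -> T, bijective f &
    forall I : {set S}, indep M (f @: I) = indep N I.

(* Main.v *)
(** If [M] has a self-adjoint, composing the adjoint map with the isomorphism gives an
   injective antitone self-map of the finite lattice of flats; counting comparable pairs
   shows that it is an anti-automorphism.  It complements ranks, so the rank function is
   both submodular and supermodular.

   Conversely, a modular simple matroid is the direct sum of projective geometries, its
   components, and it is enough to find a polarity on each of them: a symmetric relation
   for which the polar of every point is a hyperplane.  Ranks 1 and 2 are trivial.  In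
   rank at least 4, Desargues' theorem holds, so the complement [A] of a hyperplane has
   all translations and homotheties.  The translations turn [A] into an abelian group
   whose direction-preserving endomorphisms form a finite division ring, which is a field
   by Wedderburn's theorem; the dot product in the resulting homogeneous coordinates is
   the polarity. *)

(* Rank 3 is special because there a component is a projective plane. By the counting argument a
   self-adjoint plane is isomorphic to its dual, which fails for some finite planes. From rank 4 on,
   every plane has a point outside it, and such a point is what proves Desargues' theorem.
   Commutativity of the coordinate ring matters as well: over a skew field the dot product is not
   symmetric, and finiteness is what excludes skew fields.

   Homogeneous coordinates are never put on the whole projective space. Only the affine part
   receives coordinates; a point of the hyperplane at infinity is handled as a direction of lines,
   and a polar hyperplane as the zeros of an affine function together with the directions along
   which the function is constant.

   A polarity is kept as a relation on points rather than a map on flats, because relations glue: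
   points in different components are simply declared conjugate. A point may lie on its own
   polar. *)
Require Import Defs.
From HB Require Import structures.
From mathcomp Require Import all_boot all_order all_algebra all_field.
From mathcomp Require Import zify.

Set Implicit Arguments.
Unset Strict Implicit.
Unset Printing Implicit Defensive.

Import Order.TTheory GRing.Theory.

(** * Lines and flats of modular matroids *)

Section MatroidRank.
Variables (T : finType) (M : matroid T).
Implicit Types (x y z : T) (I J F X Y Z : {set T}).

Lemma rk_card X : rk M X <= #|X|.
Proof. by have [I [sIX _ <-]] := rk_basis M X; apply: subset_leq_card. Qed.

Lemma rkU1 x X : rk M (x |: X) = rk M X + (x \notin cl M X).
Proof.
rewrite inE; case: eqP => [->|/eqP nx]; first by rewrite addn0.
apply/eqP; rewrite eqn_leq addn1 ltn_neqAle eq_sym nx rkS ?subsetUr // andbT.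
have [I [sI iI <-]] := rk_basis M (x |: X).
have iIx : indep M (I :\ x) by apply: indepS iI; apply: subsetDl.
have sIx : I :\ x \subset X by rewrite subDset.
rewrite (cardsD1 x I) -add1n leq_add ?leq_b1 //; exact: rk_ge.
Qed.

(** A basis [I] of the intersection is grown to a basis [J] of [X], then to [K] of the union.
    Maximality of [J] in [X] gives [K :&: X = J], so what [K] has outside [Y] lies in [J :\: I]. *)
Lemma rk_submodular X Y :
  rk M (X :&: Y) + rk M (X :|: Y) <= rk M X + rk M Y.
Proof.
have [I [sI iI eI]] := rk_basis M (X :&: Y).
have [J [sIJ sJX iJ eJ]] := indep_extend (subset_trans sI (subsetIl X Y)) iI.
have [K [sJK sK iK <-]] := indep_extend (subset_trans sJX (subsetUl X Y)) iJ.
have hY : #|K :&: Y| <= rk M Y.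
  by rewrite rk_ge ?subsetIr // (indepS (subsetIl K Y)).
have hX : #|K :&: X| = #|J|.
  apply/eqP; rewrite eqn_leq eJ rk_ge ?subsetIr ?(indepS (subsetIl K X)) //=.
  by rewrite -eJ subset_leq_card // subsetI sJK.
have hJ : K :&: X = J.
  by apply/eqP; rewrite eq_sym eqEcard hX leqnn subsetI sJK sJX.
have sKY : K :\: Y \subset J :\: I.
  apply/subsetP=> z /setDP[zK zY].
  have /setUP[zX|] := subsetP sK z zK; last by rewrite (negPf zY).
  rewrite !inE -hJ inE zK zX !andbT.
  by apply: contra zY => /(subsetP sI)/setIP[].
have := subset_leq_card sKY; rewrite (cardsD J) (setIidPr sIJ) => h.
rewrite -(cardsID Y K) -eI addnCA -eJ addnC leq_add //.
have := subset_leq_card sIJ; lia.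
Qed.

Lemma rk_le_sub_cl X Y : X \subset Y -> rk M Y <= rk M X -> Y \subset cl M X.
Proof.
move=> sXY le; apply/subsetP=> y yY; rewrite inE eqn_leq [rk M X <= _]rkS ?subsetUr // andbT.
by apply: leq_trans le; rewrite rkS // subUset sub1set yY.
Qed.

Lemma exchange x y X :
  y \in cl M (x |: X) -> y \notin cl M X -> x \in cl M (y |: X).
Proof.
move=> yx yX; have xX : x \notin cl M X.
  apply: contra yX => xX; apply: subsetP yx.
  by rewrite cl_sub ?cl_flat // subUset sub1set xX sub_cl.
have h1 := rkU1 y (x |: X); rewrite yx addn0 (rkU1 x) xX in h1.
by rewrite inE setUCA h1 rkU1 yX.
Qed.

Lemma mem_cl x X : x \in X -> x \in cl M X.
Proof. exact/subsetP/sub_cl. Qed.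

End MatroidRank.

Notation line M x y := (cl M [set x; y]).

(** Clauses two to four spell out that the polar of a point is a hyperplane: proper, closed under
    lines, and meeting every line. Being pointwise and free of ranks, they can be checked component
    by component. *)
Definition polarity_on (T : finType) (M : matroid T) (C : {set T}) (R : rel T) : Prop :=
  [/\ {in C &, symmetric R},
      forall x, x \in C -> exists2 y, y \in C & ~~ R x y,
      forall x y z w, x \in C -> y \in C -> z \in C -> y != z ->
        R x y -> R x z -> w \in line M y z -> R x w
    & forall x y z, x \in C -> y \in C -> z \in C -> y != z ->
        exists2 w, w \in line M y z & R x w].

Section SimpleMatroid.
Variables (T : finType) (M : matroid T).
Hypothesis simpleM : simple_matroid M.
Implicit Types (a b c x y z : T) (I J F X Y Z : {set T}).

Lemma indep1 x : indep M [set x].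
Proof.
have [h _] := simpleM; apply: contraNT (h x) => nx.
apply/minsetP; split=> // B nB sB; apply/eqP; move: sB nB.
by rewrite subset1 => /orP[//|/eqP->]; rewrite indep0.
Qed.

Lemma rk1 x : rk M [set x] = 1.
Proof. by apply/eqP; rewrite eqn_leq -(cards1 x) rk_card rk_ge ?indep1. Qed.

Lemma indep2 x y : indep M [set x; y].
Proof.
have [<-|nxy] := eqVneq x y; first by rewrite setUid indep1.
have [_ h] := simpleM; apply: contraNT (h x y) => nx; rewrite /parallel nxy.
apply/minsetP; split=> // B nB sB; apply/eqP; rewrite eqEsubset sB.
have [yB|yB] := boolP (y \in B); last first.
  case/negP: nB; apply: indepS (indep1 x); apply/subsetP=> z zB.
  by have := subsetP sB z zB; rewrite !inE; case/orP=> // /eqP h2; rewrite -h2 zB in yB.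
have [xB|xB] := boolP (x \in B); first by rewrite subUset !sub1set xB yB.
case/negP: nB; apply: indepS (indep1 y); apply/subsetP=> z zB.
by have := subsetP sB z zB; rewrite !inE; case/orP=> // /eqP h2; rewrite -h2 zB in xB.
Qed.

Lemma rk2 x y : x != y -> rk M [set x; y] = 2.
Proof.
move=> nxy; have e2 : #|[set x; y]| = 2 by rewrite cards2 nxy.
by apply/eqP; rewrite eqn_leq -e2 rk_card rk_ge ?indep2.
Qed.

Lemma cl1 x : cl M [set x] = [set x].
Proof.
apply/setP=> y; rewrite !inE rk1; have [->|nyx] := eqVneq y x.
  by rewrite setUid rk1.
by rewrite rk2.
Qed.

Lemma lineC x y : line M x y = line M y x.
Proof. by rewrite setUC. Qed.

Lemma line_l x y : x \in line M x y.
Proof. by apply: mem_cl; rewrite set21. Qed.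

Lemma line_r x y : y \in line M x y.
Proof. by apply: mem_cl; rewrite set22. Qed.

Hint Resolve line_l line_r : core.

Lemma line_sub F x y : is_flat M F -> x \in F -> y \in F -> line M x y \subset F.
Proof. by move=> fF xF yF; rewrite cl_sub // subUset !sub1set xF. Qed.

Lemma line_in F x y z : is_flat M F -> x \in F -> y \in F ->
  z \in line M x y -> z \in F.
Proof. by move=> fF xF yF; apply/subsetP/line_sub. Qed.

Lemma line_eq x y u v : x != y -> u != v ->
  u \in line M x y -> v \in line M x y -> line M u v = line M x y.
Proof.
move=> nxy nuv hu hv; have s : line M u v \subset line M x y.
  by rewrite line_sub ?cl_flat.
have := @rk_le_sub_cl _ M _ _ s; rewrite !rk_cl !rk2 // (eqP (cl_flat M _)) => s'.
by apply/eqP; rewrite eqEsubset s s'.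
Qed.

Lemma line_exchange x y z : z \in line M x y -> z != x -> line M x z = line M x y.
Proof.
move=> h nz; have [exy|nxy] := eqVneq x y; last by rewrite (line_eq nxy) // eq_sym.
by move: h; rewrite -exy setUid cl1 inE (negPf nz).
Qed.

Lemma line_rot x y z : z \in line M x y -> z != x -> y \in line M x z.
Proof. by move=> h nz; rewrite (line_exchange h nz). Qed.

Section ModularMatroid.
Hypothesis modularM : modular M.

Lemma mod_rk X Y : is_flat M X -> is_flat M Y ->
  rk M (X :&: Y) + rk M (X :|: Y) = rk M X + rk M Y.
Proof.
move=> fX fY; have := modularM (Flat fX) (Flat fY).
by rewrite flat_meetE flat_joinE /= rk_cl.
Qed.

(** Modularity forces the intersection to have positive rank. This is the source of intersection
    points below. *)
Lemma meet_point X Y : is_flat M X -> is_flat M Y ->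
  rk M (X :|: Y) < rk M X + rk M Y -> exists2 z, z \in X & z \in Y.
Proof.
move=> fX fY lt; have := mod_rk fX fY.
have [->|[z /setIP[zX zY]]] := set_0Vmem (X :&: Y); last by exists z.
by have := rk_card M set0; rewrite cards0 leqn0 => /eqP->; lia.
Qed.

Lemma rk3_le x y z : rk M [set x; y; z] <= 3.
Proof.
apply: leq_trans (rk_card _ _) _; rewrite setUC cardsU1 cards2.
by case: (z \notin _); case: (x != y).
Qed.

(** The Veblen-Young axiom: both lines lie in the span of [c], [a], [b], of rank at most 3, where
    two flats of rank 2 must meet. *)
Lemma veblen c a b a' b' : a != b -> a' != b' ->
  a' \in line M c a -> b' \in line M c b ->
  exists2 w, w \in line M a b & w \in line M a' b'.
Proof.
move=> nab nab' ha hb; apply: meet_point; rewrite ?cl_flat // !rk_cl !rk2 //.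
apply: (@leq_ltn_trans 3) => //; apply: leq_trans (rk3_le c a b).
rewrite -(rk_cl M [set c; a; b]) rkS // subUset.
have hc : c \in cl M [set c; a; b] by apply: mem_cl; rewrite !inE eqxx.
have h1 : a \in cl M [set c; a; b] by apply: mem_cl; rewrite !inE eqxx ?orbT.
have h2 : b \in cl M [set c; a; b] by apply: mem_cl; rewrite !inE eqxx ?orbT.
rewrite !line_sub ?cl_flat //.
  by apply: line_in ha; rewrite ?cl_flat.
by apply: line_in hb; rewrite ?cl_flat.
Qed.

(* If [F] is a flat inside a line-closed [S] and [x \in S], modularity makes every
   line through [x] in the span of [x |: F] meet [F], so that span stays in [S]. *)
Lemma line_closed_flat (S : {set T}) :
  (forall x y z, x \in S -> y \in S -> x != y -> z \in line M x y -> z \in S) ->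
  is_flat M S.
Proof.
move=> hS.
pose P (F : {set T}) := is_flat M F && (F \subset S).
have P0 : P (cl M set0).
  rewrite /P cl_flat; apply/subsetP=> z; rewrite inE setU0 rk1.
  by have := rk_card M set0; rewrite cards0 leqn0 => /eqP->.
have [F /maxsetP[/andP[fF sF] maxF] _] := maxset_exists P0.
suff <- : F = S by [].
apply/eqP; rewrite eqEsubset sF; apply/subsetP=> x xS; apply: contraT => xF.
have sFc : F \subset cl M (x |: F) := subset_trans (subsetUr _ _) (sub_cl _ _).
have PxF : P (cl M (x |: F)).
  rewrite /P cl_flat; apply/subsetP=> y hy.
  have [yF|yF] := boolP (y \in F); first exact: subsetP sF y yF.
  have [->//|nyx] := eqVneq y x.
  have [|||z zl zF] := @meet_point (line M x y) F; rewrite ?cl_flat //.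
    rewrite rk_cl rk2 1?eq_sym //; apply: (@leq_ltn_trans (rk M F).+1) => //.
    apply: (@leq_trans (rk M (cl M (x |: F)))).
      rewrite rkS // subUset sFc andbT.
      by rewrite line_sub ?cl_flat // mem_cl // !inE eqxx.
    by rewrite rk_cl rkU1 -addn1 leq_add2l leq_b1.
  have nzx : z != x by apply: contraNneq xF => <-.
  apply: (hS x z) => //; rewrite 1?eq_sym //; last exact: line_rot.
  exact: subsetP sF z zF.
have eF := maxF _ PxF sFc.
by rewrite -eF mem_cl // !inE eqxx in xF.
Qed.

End ModularMatroid.
End SimpleMatroid.

(** * Affine spaces given by the directions of their lines *)

Section AffineDirections.
Variables (A : finType) (D : eqType) (dir : A -> A -> D).
Implicit Types (x y z w o a b c : A) (f g t s : A -> A) (p q r : D).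

(** Injectivity is built in because [dir x x] carries no information. *)
Definition dilatation f := forall x y, x != y ->
  f x != f y /\ dir (f x) (f y) = dir x y.

Definition moves_along t p := forall z, z != t z /\ dir z (t z) = p.

Definition translation t :=
  dilatation t /\ (t =1 id \/ exists p, moves_along t p).

Hypothesis dirC : forall x y, x != y -> dir x y = dir y x.
Hypothesis dirT : forall x y z, x != y -> x != z -> y != z ->
  dir x y = dir x z -> dir y z = dir x y.
Hypothesis dir2 : forall x p, exists2 y, x != y & dir x y != p.
Hypothesis transl_ex : forall x y, x != y -> exists t,
  [/\ dilatation t, t x = y & moves_along t (dir x y)].
Hypothesis homoth_ex : forall o x y, o != x -> o != y -> dir o x = dir o y ->
  exists f, [/\ dilatation f, f o = o & f x = y].

(** Lines in different directions share at most one point: a second one would give both lines the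
    direction of [u v]. *)
Lemma dir_meet x y u v : x != u -> x != v -> y != u -> y != v ->
  dir x u = dir x v -> dir y u = dir y v -> dir x u != dir y u -> u = v.
Proof.
move=> nxu nxv nyu nyv ex ey; apply: contraNeq => nuv.
by rewrite -(dirT nxu nxv nuv ex) -(dirT nyu nyv nuv ey).
Qed.

Lemma dil_inj f x y : dilatation f -> f x = f y -> x = y.
Proof.
by move=> df e; apply/eqP; apply: contraT => /df[]; rewrite e eqxx.
Qed.

Lemma dil_comp f g : dilatation f -> dilatation g -> dilatation (f \o g).
Proof.
by move=> df dg x y /dg[ng eg] /=; have [nf ef] := df _ _ ng; rewrite ef.
Qed.

(** For [z] off the line [a b], the image of [z] is the only point seen from the images of [a] and
    [b] in the directions [dir a z] and [dir b z]. Points on the line [x y] are reached through a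
    point [w] off it. *)
Lemma dil_uniq f g x y : dilatation f -> dilatation g -> x != y ->
  f x = g x -> f y = g y -> f =1 g.
Proof.
move=> df dg nxy ex ey.
have off a b z : a != b -> f a = g a -> f b = g b -> a != z ->
    dir a b != dir a z -> f z = g z.
  move=> nab ea eb naz hd.
  have nbz : b != z by apply: contraNneq hd => ->.
  have [nfa fa] := df _ _ naz; have [nfb fb] := df _ _ nbz.
  have [nga ga] := dg _ _ naz; have [ngb gb] := dg _ _ nbz.
  apply: (@dir_meet (f a) (f b)) => //; rewrite ?ea ?eb // -?ea -?eb ?fa ?fb;
    rewrite ?ea ?eb ?ga ?gb //.
  apply: contra hd => /eqP e; have nza : z != a by rewrite eq_sym.
  have nzb : z != b by rewrite eq_sym.
  by rewrite (dirT nza nzb nab) 1?dirC // e dirC // eq_sym.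
move=> z; have [<-//|nxz] := eqVneq x z.
have [e|] := eqVneq (dir x y) (dir x z); last exact: off.
have [w nxw hw] := dir2 x (dir x y).
have fw : f w = g w by apply: (off x y) => //; rewrite eq_sym.
by apply: (off x w) => //; rewrite -e.
Qed.

Lemma translation_id : translation id.
Proof. by split; [move=> x y | left]. Qed.

Lemma translation_ex x y : exists2 t, translation t & t x = y.
Proof.
have [<-|nxy] := eqVneq x y; first by exists id => //; apply: translation_id.
have [t [dt tx mt]] := transl_ex nxy; exists t => //; split=> //; right.
by exists (dir x y).
Qed.

(** Two nontrivial translations agreeing at [x] have the same direction. For [w] off that direction
    the image of [w] is the fourth vertex of a parallelogram, and two values determine a
    dilatation. *)
Lemma translation_uniq t s x : translation t -> translation s -> t x = s x -> t =1 s.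
Proof.
move=> [dt [t1|[p mt]]] [ds [s1|[q ms]]] e.
- by move=> z; rewrite t1 s1.
- by have [] := ms x; rewrite -e t1 eqxx.
- by have [] := mt x; rewrite e s1 eqxx.
have [w nxw hw] := dir2 x p.
apply: (dil_uniq dt ds nxw e).
have [ntx etx] := dt _ _ nxw; have [nsx esx] := ds _ _ nxw.
have [ntw etw] := mt w; have [nsw esw] := ms w.
have epq : p = q by have [_ <-] := mt x; have [_ <-] := ms x; rewrite e.
apply: (@dir_meet w (t x)) => //; rewrite ?e // -?e ?etw ?esw ?etx //.
  by rewrite e esx.
by rewrite eq_sym.
Qed.

(** Both composites send [z] to the fourth vertex of the parallelogram on [z], [s z], [t z]. *)
Lemma moves_comm t s p q : dilatation t -> dilatation s ->
  moves_along t p -> moves_along s q -> p != q -> forall z, t (s z) = s (t z).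
Proof.
move=> dt ds mt ms npq z.
have [ntz etz] := mt z; have [nsz esz] := ms z.
have [ntsz etsz] := mt (s z); have [nstz estz] := ms (t z).
have [n1 e1] := dt _ _ nsz; have [n2 e2] := ds _ _ ntz.
by apply: (@dir_meet (s z) (t z)); rewrite ?etsz ?estz ?e1 ?e2 ?etz ?esz.
Qed.

Lemma moves_comp o t s p q : dilatation t -> dilatation s ->
  moves_along t p -> moves_along s q -> p != q ->
  exists2 r, r != p & moves_along (t \o s) r.
Proof.
move=> dt ds mt ms npq.
have [nso eso] := ms o; have [ntso etso] := mt (s o).
have [eo|noy] := eqVneq o (t (s o)).
  by case/eqP: npq; rewrite -etso -eso -eo dirC // eq_sym.
have nsoo : s o != o by rewrite eq_sym.
have [u [du uo mu]] := transl_ex noy.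
have nrq : dir o (t (s o)) != q.
  apply: contra npq => /eqP e; rewrite -etso.
  by rewrite (dirT nso noy) ?e ?eso.
have nrp : dir o (t (s o)) != p.
  apply: contra npq => /eqP e; rewrite -eso.
  have n1 : t (s o) != o by rewrite eq_sym.
  have n2 : t (s o) != s o by rewrite eq_sym.
  by rewrite (dirT n1 n2) // -dirC // e // -dirC // etso.
exists (dir o (t (s o))) => //.
(* The direction of [u] differs from that of [s], so the two commute; hence [u] agrees with [t \o s]
   at [s o] as well as at [o]. *)
have e : t \o s =1 u.
  apply: (dil_uniq (dil_comp dt ds) du nso); first by rewrite /= uo.
  rewrite /= (moves_comm du ds mu ms nrq) uo.
  by rewrite (moves_comm dt ds mt ms npq).
by move=> z; rewrite e.
Qed.

Lemma translation_comp o t s : translation t -> translation s -> translation (t \o s).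
Proof.
move=> [dt mt] [ds ms]; split; first exact: dil_comp.
case: mt => [t1|[p mt]].
  by case: ms => [s1|[q ms]]; [left=> z /=; rewrite s1 t1 | right; exists q => z /=; rewrite t1].
case: ms => [s1|[q ms]]; first by right; exists p => z /=; rewrite s1.
have [epq|npq] := eqVneq p q; last first.
  by have [r _ mr] := moves_comp o dt ds mt ms npq; right; exists r.
rewrite -{q}epq in ms.
(* Equal directions: every moved point moves along [p]. If some [z] is fixed, a point [w] off
   direction [p] could move only along the line [z w], so it is fixed too and the composite is the
   identity. *)
have along z : z != t (s z) -> dir z (t (s z)) = p.
  move=> nz; have [nsz esz] := ms z; have [ntsz etsz] := mt (s z).
  have nszz : s z != z by rewrite eq_sym.
  by rewrite (dirT nszz ntsz nz) // -dirC // esz.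
have [/existsP[z /eqP ez]|/existsPn nz] := boolP [exists z, t (s z) == z]; last first.
  by right; exists p => z /=; rewrite eq_sym along ?nz // eq_sym nz.
left; have [w nzw hw] := dir2 z p.
have dts := dil_comp dt ds.
apply: (dil_uniq dts (proj1 translation_id) nzw) => //=.
apply/eqP; apply: contraT => nw; rewrite eq_sym in nw.
have [n e] := dts _ _ nzw; rewrite /= ez in n e.
by case/eqP: hw; rewrite -(along w nw) (dirT nzw n nw).
Qed.

(** For equal directions an auxiliary translation [v] in another direction is used: [t] commutes
    with [v] and with [s \o v], whose direction also differs from [p], hence with [s]. *)
Lemma translation_comm t s z : translation t -> translation s -> t (s z) = s (t z).
Proof.
move=> [dt [t1|[p mt]]] [ds [s1|[q ms]]]; rewrite ?t1 ?s1 //.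
have [epq|npq] := eqVneq p q; last exact: (moves_comm dt ds mt ms npq).
rewrite -{q}epq in ms.
have [y nzy hy] := dir2 z p.
have [v [dv vz mv]] := transl_ex nzy.
have npv : p != dir z y by rewrite eq_sym.
have [r nr mr] := moves_comp z ds dv ms mv npv.
have npr : p != r by rewrite eq_sym.
have /= e := moves_comm dt (dil_comp ds dv) mt mr npr z.
have ev := moves_comm dt dv mt mv npv; have esv := moves_comm ds dv ms mv npv.
by apply: (dil_inj dv); rewrite -ev -!esv -e.
Qed.

(* [a + b] is the image of [b] under the translation that takes [o] to [a]. *)
Lemma affine_group o : exists (add : A -> A -> A) (opp : A -> A),
  [/\ [/\ associative add, commutative add, left_id o add & left_inverse o opp add],
      (forall c a b, a != b -> add c a != add c b /\ dir (add c a) (add c b) = dir a b)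
    & forall x y, o != x -> o != y -> dir o x = dir o y ->
      exists f, [/\ {morph f : a b / add a b}, f x = y &
        forall z, o != z -> o != f z /\ dir o (f z) = dir o z]].
Proof.
have [tau Htau] : exists tau : A -> {ffun A -> A},
    forall a, translation (tau a) /\ tau a o = a.
  apply: (@fin_all_exists A (fun _ => {ffun A -> A})
     (fun a (t : {ffun A -> A}) => translation t /\ t o = a)) => a.
  have [t [dt mt] ta] := translation_ex o a; exists (finfun t).
  split; last by rewrite ffunE.
  split; first by move=> x y; rewrite !ffunE; apply: dt.
  case: mt => [t1|[p mp]]; [left=> z|right; exists p => z]; rewrite ffunE;
    [apply: t1 | apply: mp].
have tr a : translation (tau a) by case: (Htau a).
have dil a : dilatation (tau a) by case: (tr a).
have tauo a : tau a o = a by case: (Htau a).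
have [opp Hopp] : exists opp : A -> A, forall a, tau a (opp a) = o.
  apply: (@fin_all_exists A (fun _ => A) (fun a b => tau a b = o)) => a.
  have inj : injective (tau a) by move=> x y; apply: dil_inj.
  by exists (invF inj o); rewrite f_invF.
have addC : commutative (fun a b => tau a b).
  by move=> a b; rewrite -{1}(tauo b) (translation_comm _ (tr a) (tr b)) tauo.
exists (fun a b => tau a b), opp; split; first split.
- move=> a b c.
  apply: (translation_uniq (translation_comp o (tr a) (tr b)) (tr _) (x := o)).
  by rewrite /= !tauo.
- exact: addC.
- move=> b.
  by apply: (translation_uniq (tr o) translation_id (x := o)); rewrite tauo.
- by move=> a; rewrite addC.
- by move=> c a b /(dil c).
move=> x y nox noy exy; have [f [df fo fx]] := homoth_ex nox noy exy.
exists f; split=> //; last by move=> z /df[]; rewrite fo.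
move=> a b; have [<-|noa] := eqVneq o a.
  have tid : tau o =1 id by apply: (translation_uniq (tr o) translation_id (x := o)); rewrite tauo.
  by rewrite fo !tid.
suff /(_ b) : f \o tau a =1 tau (f a) \o f by [].
(* Both sides send [c], taken off the line [o a], to the fourth vertex of the parallelogram on [o],
   [f a], [f c]. *)
have [c noc hc] := dir2 o (dir o a).
apply: (dil_uniq (dil_comp df (dil a)) (dil_comp (dil (f a)) df) noc).
  by rewrite /= fo !tauo.
have [n1 e1] := df _ _ noc; have [n2 e2] := df _ _ noa; rewrite fo in n1 e1 n2 e2.
have [n3 e3] := dil c _ _ noa; have [n4 e4] := dil a _ _ noc.
rewrite !tauo addC in n3 e3 n4 e4.
have [n5 e5] := df _ _ n3; have [n6 e6] := df _ _ n4.
have [n7 e7] := dil (f c) _ _ n2; have [n8 e8] := dil (f a) _ _ n1.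
rewrite !tauo addC in n7 e7 n8 e8.
apply: (@dir_meet (f c) (f a)) => //=.
- by rewrite e5 e3 e7 e2.
- by rewrite e6 e4 e8 e1.
- by rewrite e5 e3 e6 e4 eq_sym.
Qed.

End AffineDirections.

Local Open Scope ring_scope.

(** * Coordinates for a finite abelian group partitioned into lines *)

Section FiniteModule.
Variables (F : finFieldType) (V : finZmodType) (act : F -> V -> V).
Hypotheses (actDr : forall a x y, act a (x + y) = act a x + act a y)
  (actDl : forall a b x, act (a + b) x = act a x + act b x)
  (actA : forall a b x, act (a * b) x = act a (act b x))
  (act1 : forall x, act 1 x = x).

Let lin n (e : {ffun 'I_n -> V}) (r : 'rV[F]_n) : V := \sum_i act (r 0 i) (e i).

(** A basis is a longest tuple whose linear combinations are pairwise distinct; its length is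
    bounded because there are at most [#|V|] combinations. A vector outside the span would lengthen
    it. *)
Lemma finite_module_coord : exists n (phi : V -> 'rV[F]_n),
  [/\ bijective phi, {morph phi : x y / x + y} &
      forall a x, phi (act a x) = a *: phi x].
Proof.
have act0 a : act a 0 = 0 by apply: (addIr (act a 0)); rewrite -actDr !add0r.
have act0l x : act 0 x = 0 by apply: (addIr (act 0 x)); rewrite -actDl !add0r.
have linD n e (r s : 'rV[F]_n) : lin e (r + s) = lin e r + lin e s.
  by rewrite /lin -big_split; apply: eq_bigr => i _; rewrite mxE actDl.
have linZ n e a (r : 'rV[F]_n) : lin e (a *: r) = act a (lin e r).
  rewrite /lin (big_morph (act a) (actDr a) (act0 a)).
  by apply: eq_bigr => i _; rewrite mxE actA.
have lin0 n e : lin e (0 : 'rV[F]_n) = 0 by rewrite -(scale0r 0) linZ act0l.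
pose P n := [exists e : {ffun 'I_n -> V}, injectiveb (lin e)].
have exP : exists n, P n.
  exists 0%N; apply/existsP; exists [ffun=> 0]; apply/injectiveP=> r s _.
  by apply/rowP; case.
have boundP n : P n -> (n <= #|V|)%N.
  case/existsP=> e /injectiveP/leq_card; rewrite card_mx mul1n.
  by apply: leq_trans; apply/ltnW/ltn_expl/finNzRing_gt1.
have [n /existsP[e /injectiveP inje] maxn] := ex_maxnP exP boundP.
have surj v : exists r, lin e r == v.
  apply/existsP; apply: contraT => /existsPn nv.
  suff /maxn : P n.+1 by rewrite ltnn.
  pose e' : {ffun 'I_n.+1 -> V} := [ffun i => oapp e v (unlift ord0 i)].
  apply/existsP; exists e'; apply/injectiveP.
  have linE r : lin e' r = act (r 0 0) v + lin e (\row_j r 0 (lift ord0 j)).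
    rewrite /lin big_ord_recl ffunE unlift_none; congr (_ + _).
    by apply: eq_bigr => i _; rewrite mxE ffunE liftK.
  have ker r : lin e' r = 0 -> r = 0.
    rewrite linE => er; have [r0|nr0] := eqVneq (r 0 0) 0.
      rewrite r0 act0l add0r in er.
      have /rowP h := inje _ _ (etrans er (esym (lin0 _ _))).
      apply/rowP=> i; case: (unliftP ord0 i) => [j ->|->]; last by rewrite r0 mxE.
      by have := h j; rewrite !mxE.
    case/eqP: (nv (- (r 0 0)^-1 *: (\row_j r 0 (lift ord0 j)))).
    have -> : v = act (r 0 0)^-1 (act (r 0 0) v) by rewrite -actA mulVf ?act1.
    rewrite linZ; apply: (addrI (act (r 0 0)^-1 (lin e (\row_j r 0 (lift ord0 j))))).
    by rewrite -actDl subrr act0l -actDr [X in act _ X]addrC er act0.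
  move=> r s ers; apply/eqP; rewrite -subr_eq0; apply/eqP/ker.
  by apply: (addIr (lin e' s)); rewrite -linD subrK add0r.
have [phi phiK] : exists phi : V -> 'rV[F]_n, forall v, lin e (phi v) = v.
  apply: (@fin_all_exists V (fun _ => 'rV[F]_n) (fun v r => lin e r = v)) => v.
  by have [r /eqP] := surj v; exists r.
exists n, phi; split.
- by exists (lin e) => // r; apply: inje; rewrite phiK.
- by move=> x y; apply: inje; rewrite linD !phiK.
- by move=> a x; apply: inje; rewrite linZ !phiK.
Qed.
End FiniteModule.

(** A group partition in the sense of André: each class of nonzero vectors with the same direction
    becomes a subgroup once 0 is added. [spread_dir2] says that no class is everything,
    [spread_homoth] that direction-preserving endomorphisms act transitively on each class. The
    direction of 0 has no meaning. *)
Record line_spread := LineSpread {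
  spread_zmod : finZmodType;
  spread_dir_type : eqType;
  spread_dir : spread_zmod -> spread_dir_type;
  spread_dirD : forall x y, x != 0 -> y != 0 -> x + y != 0 ->
    spread_dir x = spread_dir y -> spread_dir (x + y) = spread_dir x;
  spread_dirN : forall x, x != 0 -> spread_dir (- x) = spread_dir x;
  spread_dir2 : forall p, exists2 x, x != 0 & spread_dir x != p;
  spread_homoth : forall x y, x != 0 -> y != 0 -> spread_dir x = spread_dir y ->
    exists f : spread_zmod -> spread_zmod,
      [/\ {morph f : a b / a + b}, f x = y &
        forall z, z != 0 -> f z != 0 /\ spread_dir (f z) = spread_dir z] }.

Section SpreadKernel.
Variable s : line_spread.
Local Notation V := (spread_zmod s).
Local Notation dir := (@spread_dir s).
Implicit Types (x y z : V) (f g : {ffun V -> V}).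

(** The kernel of the spread: its elements are the future scalars. *)
Definition kernel_pred f :=
  [forall x, forall y, f (x + y) == f x + f y] &&
  [forall x, (f x == 0) || (dir (f x) == dir x)].

Lemma kernelP f : reflect ({morph f : x y / x + y} /\
  forall x, f x != 0 -> dir (f x) = dir x) (kernel_pred f).
Proof.
apply: (iffP andP) => [[/'forall_'forall_eqP h1 /forallP h2]|[h1 h2]].
  by split=> // x nx; have := h2 x; rewrite (negPf nx) => /eqP.
split; first by apply/'forall_'forall_eqP.
apply/forallP=> x; case: eqVneq => //= nx; exact/eqP/h2.
Qed.

Lemma kernel_zmod_closed : zmod_closed kernel_pred.
Proof.
split=> [|f g /kernelP[f1 f2] /kernelP[g1 g2]]; apply/kernelP.
  by split=> [x y|x]; rewrite !ffunE ?addr0 ?eqxx.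
split=> [x y|x]; rewrite !ffunE; first by rewrite f1 g1 opprD addrACA.
have [->|ng] := eqVneq (g x) 0; first by rewrite subr0; apply: f2.
have [->|nf] := eqVneq (f x) 0; first by rewrite sub0r => _; rewrite spread_dirN // g2.
by move=> n; rewrite spread_dirD ?oppr_eq0 ?spread_dirN ?f2 ?g2.
Qed.

HB.instance Definition _ := GRing.isZmodClosed.Build {ffun V -> V} kernel_pred
  kernel_zmod_closed.

Definition kernel := {f : {ffun V -> V} | kernel_pred f}.
HB.instance Definition _ := SubFinite.on kernel.
HB.instance Definition _ := [SubChoice_isSubZmodule of kernel by <:].

Implicit Types (a b c : kernel).

Lemma kernelD a x y : val a (x + y) = val a x + val a y.
Proof. by case/kernelP: (valP a). Qed.

Lemma kernel_dir a x : val a x != 0 -> dir (val a x) = dir x.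
Proof. by case/kernelP: (valP a) => _; apply. Qed.

Lemma kernel0 a : val a 0 = 0.
Proof. by apply: (addIr (val a 0)); rewrite -kernelD !add0r. Qed.

Lemma kernel_addE a b x : val (a + b) x = val a x + val b x.
Proof. by rewrite raddfD ffunE. Qed.

Lemma kernel_one_subproof : kernel_pred [ffun x => x].
Proof. by apply/kernelP; split=> [x y|x]; rewrite !ffunE. Qed.
Definition kernel_one : kernel := Sub [ffun x => x] kernel_one_subproof.

Lemma kernel_mul_subproof a b : kernel_pred [ffun x => val a (val b x)].
Proof.
apply/kernelP; split=> [x y|x]; rewrite !ffunE ?kernelD // => nabx.
by rewrite !kernel_dir //; apply: contraNneq nabx => ->; rewrite kernel0.
Qed.
Definition kernel_mul a b : kernel :=
  Sub [ffun x => val a (val b x)] (kernel_mul_subproof a b).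

Lemma kernel_eqP a b : val a =1 val b -> a = b.
Proof. by move=> e; apply/val_inj/ffunP. Qed.

Lemma kernel_mulA : associative kernel_mul.
Proof. by move=> a b c; apply: kernel_eqP => x; rewrite !ffunE. Qed.
Lemma kernel_mul1 : left_id kernel_one kernel_mul.
Proof. by move=> a; apply: kernel_eqP => x; rewrite !ffunE. Qed.
Lemma kernel_1mul : right_id kernel_one kernel_mul.
Proof. by move=> a; apply: kernel_eqP => x; rewrite !ffunE. Qed.
Lemma kernel_mulDl : left_distributive kernel_mul +%R.
Proof. by move=> a b c; apply: kernel_eqP => x; rewrite !ffunE. Qed.
Lemma kernel_mulDr : right_distributive kernel_mul +%R.
Proof. by move=> a b c; apply: kernel_eqP => x; rewrite !ffunE kernelD. Qed.
Lemma kernel_one_neq0 : kernel_one != 0.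
Proof.
apply/negP => /eqP e; have [x nx _] := spread_dir2 (dir 0).
by case/eqP: nx; have := congr1 (fun a : kernel => val a x) e; rewrite raddf0 !ffunE.
Qed.

HB.instance Definition _ := GRing.Zmodule_isNzRing.Build kernel
  kernel_mulA kernel_mul1 kernel_1mul kernel_mulDl kernel_mulDr kernel_one_neq0.
HB.instance Definition _ := FinRing.isNzRing.Build kernel.

Lemma kernel_mulE a b x : val (a * b) x = val a (val b x).
Proof. by rewrite ffunE. Qed.

(** Suppose [a] kills [x]. For [y] in another direction, [a] has the same value at [y] and at
    [x + y]; were it nonzero, these two would share a direction, and so would [x]. Hence [a] kills
    every vector off the direction of [x], and then, starting from such a vector, the remaining
    ones. *)
Lemma kernel_neq0 a x : a != 0 -> x != 0 -> val a x != 0.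
Proof.
move=> na nx; apply: contraNneq na => ax0; apply/eqP/kernel_eqP => z.
rewrite raddf0 ffunE.
have off x1 y1 : x1 != 0 -> y1 != 0 -> dir x1 != dir y1 -> val a x1 = 0 -> val a y1 = 0.
  move=> nx1 ny1 nd e; apply/eqP; apply: contraT => ny.
  have nxy : x1 + y1 != 0.
    by apply: contraNneq nd => /eqP; rewrite addr_eq0 => /eqP->; rewrite spread_dirN.
  have exy : val a (x1 + y1) = val a y1 by rewrite kernelD e add0r.
  have e1 : dir (x1 + y1) = dir y1 by rewrite -(kernel_dir ny) -exy kernel_dir ?exy.
  case/eqP: nd; rewrite -[in LHS](addrK y1 x1) spread_dirD ?oppr_eq0 ?addrK //.
  by rewrite spread_dirN.
have [->|nz] := eqVneq z 0; first exact: kernel0.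
have [e|nd] := eqVneq (dir x) (dir z); last exact: (off x).
have [w nw hw] := spread_dir2 (dir x).
have aw : val a w = 0 by apply: (off x); rewrite // eq_sym.
by apply: (off w) => //; rewrite -e.
Qed.

Lemma kernel_domain : GRing.integral_domain_axiom kernel.
Proof.
move=> a b ab0; apply: contraT; rewrite negb_or => /andP[na nb].
have [x nx _] := spread_dir2 (dir 0).
have := kernel_neq0 na (kernel_neq0 nb nx).
by rewrite -kernel_mulE ab0 raddf0 ffunE eqxx.
Qed.

Theorem spread_coord : exists (F : finFieldType) n (phi : V -> 'rV[F]_n),
  [/\ bijective phi, {morph phi : x y / x + y} &
      forall x y, x != 0 -> y != 0 ->
        (dir x = dir y <-> exists t, phi y = t *: phi x)].
Proof.
(* Wedderburn's theorem enters here: a finite ring without zero divisors is commutative. *)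
pose F := FinDomainFieldType kernel_domain.
pose act (a : F) x := val (a : kernel) x.
have [n [phi [bphi phiD phiZ]]] := @finite_module_coord F V act
  kernelD kernel_addE kernel_mulE (fun x => ffunE _ _).
exists F, n, phi; split=> // x y nx ny; split=> [e|[t et]].
  (* The homothety taking [x] to [y] is itself a scalar. *)
  have [f [fD fx fn]] := spread_homoth nx ny e.
  have kf : kernel_pred (finfun f).
    apply/kernelP; split=> [z1 z2|z]; rewrite !ffunE ?fD //.
    have [->|nz _] := eqVneq z 0; last by case: (fn z nz).
    suff -> : f 0 = 0 by rewrite eqxx.
    by apply: (addIr (f 0)); rewrite -fD !add0r.
  exists (Sub (finfun f) kf : kernel); rewrite -phiZ; congr phi.
  by rewrite /act SubK ffunE.
rewrite -phiZ in et; have := bij_inj bphi et => ey.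
by rewrite ey kernel_dir //; rewrite ey in ny.
Qed.
End SpreadKernel.

Section AffineCoordinates.
Variables (A : finType) (D : eqType) (dir : A -> A -> D).
Implicit Types (x y z w o a b c : A).
Hypothesis dirC : forall x y, x != y -> dir x y = dir y x.
Hypothesis dirT : forall x y z, x != y -> x != z -> y != z ->
  dir x y = dir x z -> dir y z = dir x y.
Hypothesis dir2 : forall x p, exists2 y, x != y & dir x y != p.
Hypothesis transl_ex : forall x y, x != y -> exists t,
  [/\ dilatation dir t, t x = y & moves_along dir t (dir x y)].
Hypothesis homoth_ex : forall o x y, o != x -> o != y -> dir o x = dir o y ->
  exists f, [/\ dilatation dir f, f o = o & f x = y].

Lemma affine_coord o : exists (F : finFieldType) n (phi : A -> 'rV[F]_n),
  [/\ bijective phi, phi o = 0 &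
    forall a b x y, a != b -> x != y ->
      (dir a b = dir x y <-> exists t, phi y - phi x = t *: (phi b - phi a))].
Proof.
have [add [opp [[addA addC add0 addN] transl homoth]]] :=
  affine_group dirC dirT dir2 transl_ex homoth_ex o.
pose zA := GRing.isZmodule.Build A addA addC add0 addN.
pose V : finZmodType := HB.pack A zA.
pose d (x : V) : D := dir o x.
have dD (x y : V) : x != 0 -> y != 0 -> x + y != 0 -> d x = d y -> d (x + y) = d x.
  move=> nx ny nxy e; have noy : o != y by rewrite eq_sym.
  have [n1 e1] := transl x o y noy.
  rewrite addC add0 -/(d y) -e in n1 e1.
  have nxo : x != o := nx; have noxy : o != x + y by rewrite eq_sym.
  by rewrite /d (dirT nxo n1 noxy) ?e1 dirC.
have dN (x : V) : x != 0 -> d (- x) = d x.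
  move=> nx; have [n e] := transl (opp x) x o nx.
  rewrite addN addC add0 in n e.
  by rewrite /d e dirC.
have d2 p : exists2 x : V, x != 0 & d x != p.
  by have [y n e] := dir2 o p; exists y; rewrite // eq_sym.
have dh (x y : V) : x != 0 -> y != 0 -> d x = d y -> exists f : V -> V,
    [/\ {morph f : a b / a + b}, f x = y & forall z : V, z != 0 -> f z != 0 /\ d (f z) = d z].
  move=> nx ny e; have [| |f [f1 f2 f3]] := homoth x y _ _ e; try by rewrite eq_sym.
  exists f; split=> // z nz; have [|h1 h2] := f3 z; first by rewrite eq_sym.
  by rewrite eq_sym.
have [F [n [phi [bphi phiD phiP]]]] : exists (F : finFieldType) n (phi : V -> 'rV[F]_n),
    [/\ bijective phi, {morph phi : x y / x + y} & forall x y : V, x != 0 -> y != 0 ->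
      (d x = d y <-> exists t, phi y = t *: phi x)].
  exact: spread_coord (LineSpread dD dN d2 dh).
have phi0 : phi (0 : V) = 0 by apply: (addIr (phi (0 : V))); rewrite -phiD !add0r.
have phiB (x y : V) : phi (x - y) = phi x - phi y.
  by apply: (addIr (phi y)); rewrite -phiD !subrK.
exists F, n, phi; split=> // a b x y nab nxy.
(* Translating by [opp u] moves [u] to the origin without changing the direction, so directions of
   pairs become directions of vectors. *)
have dB (u v : V) : u != v -> dir u v = d (v - u).
  move=> nuv; have [_ <-] := transl (opp u) u v nuv.
  by rewrite addN addC.
rewrite !dB // -!phiB; apply: phiP; by rewrite subr_eq0 eq_sym.
Qed.
End AffineCoordinates.

Local Close Scope ring_scope.

(** * Desargues' theorem and the polarity of a projective geometry *)

Section Desargues.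
Variables (T : finType) (M : matroid T).
Hypotheses (simpleM : simple_matroid M) (modularM : modular M).
Variables (C H : {set T}).
Hypotheses (flatC : is_flat M C) (flatH : is_flat M H) (sHC : H \subset C).
Hypothesis third : forall x y, x \in C -> y \in C -> x != y ->
  exists z, [/\ z \in line M x y, z != x & z != y].
Hypothesis meetH : forall x y, x \in C -> y \in C -> x != y ->
  exists2 h, h \in H & h \in line M x y.
Hypothesis rankC : 3 < rk M C.
Implicit Types (c p q r x y z w h u v : T) (P : {set T}).

Hint Resolve line_l line_r : core.
Local Notation lineC := (lineC M).

Definition aff x := (x \in C) && (x \notin H).

(** The point at infinity of the line [x y]. The default is reached only when the line misses [H],
    as when [x] and [y] are one affine point; [dir_in] excludes it for distinct affine points. *)
Definition dir x y := odflt x [pick h in line M x y :&: H].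

Lemma affC x : aff x -> x \in C. Proof. by case/andP. Qed.
Lemma affH x : aff x -> x \notin H. Proof. by case/andP. Qed.

Lemma aff_neqH x h : aff x -> h \in H -> x != h.
Proof. by move=> /affH xH hH; apply: contraNneq xH => ->. Qed.

Lemma dir_in x y : aff x -> aff y -> x != y ->
  dir x y \in H /\ dir x y \in line M x y.
Proof.
move=> ax ay nxy; rewrite /dir; case: pickP => [h /setIP[]//|h0].
have [h hH hl] := meetH (affC ax) (affC ay) nxy.
by have := h0 h; rewrite inE hl hH.
Qed.

(** Two points of [H] on the line would put the whole line, and so [x], into [H]. *)
Lemma line_H_eq x y h k : aff x -> h \in line M x y -> k \in line M x y ->
  h \in H -> k \in H -> h = k.
Proof.
move=> ax hl kl hH kH; apply/eqP; apply: contraT => nhk.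
have nxy : x != y.
  apply: contraNneq nhk => exy; move: hl kl.
  by rewrite -exy setUid cl1 // !inE => /eqP-> /eqP->.
case/negP: (affH ax); apply: (@line_in _ M H h k) => //.
by rewrite (line_eq simpleM nxy nhk).
Qed.

Lemma dir_eq x y h : aff x -> aff y -> x != y -> h \in line M x y -> h \in H ->
  dir x y = h.
Proof.
move=> ax ay nxy hl hH; have [dH dl] := dir_in ax ay nxy.
exact: line_H_eq dl hl dH hH.
Qed.

Lemma dirC x y : aff x -> aff y -> x != y -> dir x y = dir y x.
Proof.
move=> ax ay nxy; have [dH dl] := dir_in ax ay nxy; symmetry.
by apply: dir_eq; rewrite // 1?eq_sym // lineC.
Qed.

Lemma dir_line x y : aff x -> aff y -> x != y -> line M x (dir x y) = line M x y.
Proof.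
move=> ax ay nxy; have [dH dl] := dir_in ax ay nxy.
by apply: line_exchange => //; rewrite eq_sym; apply: aff_neqH.
Qed.

Lemma dir_on_line x y z : aff x -> aff y -> aff z -> x != y -> x != z ->
  dir x y = dir x z -> z \in line M x y.
Proof.
move=> ax ay az nxy nxz e.
by rewrite -(dir_line ax ay nxy) e (dir_line ax az nxz).
Qed.

Lemma line_dir x y u v : aff x -> aff y -> aff u -> aff v -> x != y -> u != v ->
  line M x y = line M u v -> dir x y = dir u v.
Proof.
move=> ax ay au av nxy nuv e; have [dH dl] := dir_in au av nuv.
by apply: dir_eq => //; rewrite e.
Qed.

Lemma dir_trans x y z : aff x -> aff y -> aff z -> x != y -> x != z -> y != z ->
  dir x y = dir x z -> dir y z = dir x y.
Proof.
move=> ax ay az nxy nxz nyz e; apply: line_dir => //.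
by apply: (line_eq simpleM) => //; apply: dir_on_line.
Qed.

(** A third point of the line [x h] is affine, as otherwise the line would lie in [H]. So each point
    at infinity is a direction at every affine point. *)
Lemma aff_third x h : aff x -> h \in H ->
  exists y, [/\ aff y, x != y & dir x y = h].
Proof.
move=> ax hH; have nxh := aff_neqH ax hH.
have [y [yl nyx nyh]] := third (affC ax) (subsetP sHC _ hH) nxh.
have yC : y \in C.
  by apply: (@line_in _ M C x h) => //; [exact: affC | exact: subsetP hH].
have hl : h \in line M x y by apply: line_rot.
have ay : aff y.
  rewrite /aff yC; apply: contra (affH ax) => yH.
  apply: (@line_in _ M H y h) => //; rewrite lineC.
  by apply: (line_rot simpleM) => //; rewrite lineC.
by exists y; split; rewrite 1?eq_sym //; apply: dir_eq; rewrite // eq_sym.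
Qed.

(** This is where rank at least 4 enters. If the point found outside [P] is at infinity, an affine
    point on its line through [x] replaces it. *)
Lemma aff_outside x P : is_flat M P -> aff x -> x \in P -> rk M P <= 3 ->
  exists2 w, aff w & w \notin P.
Proof.
move=> fP ax xP rP.
have [w wC wP] : exists2 w, w \in C & w \notin P.
  apply/subsetPn; apply: contraTN rankC => sCP; rewrite -leqNgt.
  by apply: leq_trans rP; apply: rkS.
have [wH|wH] := boolP (w \in H); last by exists w; rewrite /aff ?wC.
have [y [ay nxy dy]] := aff_third ax wH.
exists y => //; apply: contra wP => yP.
have [_ dl] := dir_in ax ay nxy; rewrite dy in dl.
exact: (@line_in _ M P x y).
Qed.

Lemma line_neq c x y : y \notin line M c x -> x != y.
Proof. by apply: contraNneq => <-. Qed.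

Lemma line_neqc c x y : y \notin line M c x -> y != c.
Proof. by apply: contraNneq => ->. Qed.

Lemma line_notinC c x y : x != c -> y \notin line M c x -> x \notin line M c y.
Proof. by move=> nxc; apply: contra => h; apply: line_rot. Qed.

Lemma persp_uniq a b p x y : aff p -> aff x -> aff y -> p \notin line M a b ->
  x \in line M a b -> y \in line M a b -> dir p x = dir p y -> x = y.
Proof.
move=> ap ax ay npl hx hy e; apply/eqP; apply: contraT => nxy.
have npx : p != x by apply: contraNneq npl => ->.
have npy : p != y by apply: contraNneq npl => ->.
have nab : a != b.
  by apply: contraNneq nxy => eab; move: hx hy;
     rewrite -eab setUid cl1 // !inE => /eqP-> /eqP->.
case/negP: npl; rewrite -(line_eq simpleM nab nxy) //.
have yl := dir_on_line ap ax ay npx npy e.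
by rewrite lineC in yl; rewrite (line_rot simpleM) // eq_sym.
Qed.

(** The parallel to [p x] through [p'] meets the ray [c x], by [veblen] with vertex [p]; the rest
    shows that the meeting point is affine and is not [c]. *)
Lemma persp_ex c p p' x : aff p -> aff p' -> aff x -> p != c -> p' != c ->
  p' \in line M c p -> x \notin line M c p ->
  exists x', [/\ aff x', x' != c, x' \in line M c x & dir p x = dir p' x'].
Proof.
move=> ap ap' ax npc np'c hp' hx.
have npx := line_neq hx; have nxc := line_neqc hx.
have ncx : c != x by rewrite eq_sym.
have ncp : c != p by rewrite eq_sym.
have [hH hl] := dir_in ap ax npx; set h := dir p x in hH hl *.
have lcp' : line M c p' = line M c p by apply: line_exchange.
have hpx := line_notinC npc hx.
have hnc : h \notin line M c x.
  apply: contra hpx => hcx.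
  have e := line_eq simpleM ncx (aff_neqH ax hH) (line_r _ _ _) hcx.
  rewrite -e; apply: (line_rot simpleM); first by rewrite lineC.
  by rewrite eq_sym; apply: aff_neqH.
have nph := aff_neqH ap hH.
have hncp : h \notin line M c p.
  apply: contra hx => hcp.
  have e := line_eq simpleM ncp nph (line_r _ _ _) hcp.
  by rewrite -e; apply: (line_rot simpleM) => //; rewrite eq_sym.
have [w wcx wp'h] : exists2 w, w \in line M c x & w \in line M p' h.
  apply: (@veblen _ M simpleM modularM p) => //; first exact: aff_neqH.
  by rewrite lineC.
have wC : w \in C by apply: line_in wp'h; rewrite ?(affC ap') ?(subsetP sHC).
have nwp' : p' != w.
  apply: contraNneq hpx => ep'; rewrite -ep' in wcx.
  by rewrite -(line_exchange simpleM wcx np'c) lcp'.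
have nwh : h != w by apply: contraNneq hnc => ->.
have e := line_exchange simpleM wp'h; rewrite eq_sym nwp' in e.
have aw : aff w.
  rewrite /aff wC; apply: contra nwh => wH; apply/eqP.
  exact: (line_H_eq ap' _ wp'h).
have hw : h \in line M p' w by rewrite e.
exists w; split=> //.
  apply: contraNneq hncp => ewc; rewrite ewc in hw.
  by rewrite -lcp' lineC.
by rewrite (@dir_eq p' w h).
Qed.

(** The centre [c] may be affine or lie in [H], so homotheties and translations get a common
    proof. *)
Definition on_ray c x x' := [/\ aff x, x != c, aff x', x' != c & x' \in line M c x].

Lemma on_ray_line c x x' : on_ray c x x' -> line M c x' = line M c x.
Proof. by case=> _ _ _ nx' h; apply: line_exchange. Qed.

Lemma on_ray_notin c x x' y y' : on_ray c x x' -> on_ray c y y' ->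
  y \notin line M c x -> y' \notin line M c x'.
Proof.
move=> rx ry; rewrite (on_ray_line rx); apply: contra => h.
by have [_ _ _ ny' _] := ry; rewrite -(line_exchange simpleM h ny') (on_ray_line ry).
Qed.

(* When the three rays are not coplanar, the planes [xyz] and [x'y'z'] are distinct,
   so they meet in a line, which lies in [H] as it contains the points at infinity of
   [xy] and [xz]; the intersection point of [yz] and [y'z'] is on that line. *)
Lemma desargues_nonplanar c x y z x' y' z' :
  on_ray c x x' -> on_ray c y y' -> on_ray c z z' ->
  y \notin line M c x -> z \notin cl M [set c; x; y] ->
  dir x y = dir x' y' -> dir x z = dir x' z' -> dir y z = dir y' z'.
Proof.
move=> rx ry rz hy hz exy exz.
have [ax nxc ax' nx'c hx'] := rx; have [ay nyc ay' ny'c hy'] := ry.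
have [az nzc az' nz'c hz'] := rz.
have sub2 u v : u \in [set c; x; y] -> v \in [set c; x; y] ->
    line M u v \subset cl M [set c; x; y].
  by move=> hu hv; rewrite line_sub ?cl_flat ?mem_cl.
have zcx : z \notin line M c x.
  by apply: contra hz; apply/subsetP/sub2; rewrite !inE eqxx ?orbT.
have zcy : z \notin line M c y.
  by apply: contra hz; apply/subsetP/sub2; rewrite !inE eqxx ?orbT.
have zxy : z \notin line M x y.
  by apply: contra hz; apply/subsetP/sub2; rewrite !inE eqxx ?orbT.
(* If [x] is fixed, so are [y] and [z]. Otherwise [c] can be recovered below from the line
   [x x']. *)
have [exx'|nxx'] := eqVneq x x'.
  rewrite -exx' in exy exz.
  rewrite -(@persp_uniq c y x y y') ?(line_notinC nxc) //.
  by rewrite -(@persp_uniq c z x z z') ?(line_notinC nxc).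
have nxy := line_neq hy; have nxz := line_neq zcx; have nyz := line_neq zcy.
have hy2 := on_ray_notin rx ry hy; have hz2 := on_ray_notin rx rz zcx.
have hyz2 := on_ray_notin ry rz zcy.
have nxy' := line_neq hy2; have nxz' := line_neq hz2; have nyz' := line_neq hyz2.
set P := cl M [set x; y; z]; set P' := cl M [set x'; y'; z'].
have inP u v : u \in [set x; y; z] -> v \in [set x; y; z] -> line M u v \subset P.
  by move=> hu hv; rewrite line_sub ?cl_flat ?mem_cl.
have inP' u v : u \in [set x'; y'; z'] -> v \in [set x'; y'; z'] -> line M u v \subset P'.
  by move=> hu hv; rewrite line_sub ?cl_flat ?mem_cl.
have [uH ul] := dir_in ax ay nxy; have [u'H ul'] := dir_in ax' ay' nxy'.
have [vH vl] := dir_in ax az nxz; have [v'H vl'] := dir_in ax' az' nxz'.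
rewrite -exy in ul'; rewrite -exz in vl'.
set u := dir x y in uH ul ul'; set v := dir x z in vH vl vl'.
have uP : u \in P :&: P'.
  by rewrite inE (subsetP (inP _ _ _ _) _ ul) ?(subsetP (inP' _ _ _ _) _ ul') // !inE eqxx ?orbT.
have vP : v \in P :&: P'.
  by rewrite inE (subsetP (inP _ _ _ _) _ vl) ?(subsetP (inP' _ _ _ _) _ vl') // !inE eqxx ?orbT.
have nuv : u != v by apply: contra zxy => /eqP; apply: dir_on_line.
have [w wl wl'] := veblen simpleM modularM nyz nyz' hy' hz'.
have wP : w \in P :&: P'.
  by rewrite inE (subsetP (inP _ _ _ _) _ wl) ?(subsetP (inP' _ _ _ _) _ wl') // !inE eqxx ?orbT.
have fI : is_flat M (P :&: P') by rewrite setI_flat ?cl_flat.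
(* Were the two planes equal, the plane would contain [x] and [x'], hence [c], and so the four
   independent points [c], [x], [y], [z]. *)
have rI : rk M (P :&: P') <= 2.
  rewrite leqNgt; apply/negP => r3.
  have sP : P \subset P :&: P'.
    rewrite -[P :&: P'](eqP fI) rk_le_sub_cl ?subsetIl //.
    by apply: leq_trans r3; rewrite rk_cl rk3_le.
  have sP' : P' \subset P :&: P'.
    rewrite -[P :&: P'](eqP fI) rk_le_sub_cl ?subsetIr //.
    by apply: leq_trans r3; rewrite rk_cl rk3_le.
  have xP : x \in P by apply: mem_cl; rewrite !inE eqxx.
  have yP : y \in P by apply: mem_cl; rewrite !inE eqxx ?orbT.
  have zP : z \in P by apply: mem_cl; rewrite !inE eqxx ?orbT.
  have x'P : x' \in P.
    have : x' \in P' by apply: mem_cl; rewrite !inE eqxx.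
    by move/(subsetP sP'); rewrite inE => /andP[].
  have cP : c \in P.
    apply: (@line_in _ M P x x') => //; first exact: cl_flat.
    by apply: (line_rot simpleM); rewrite 1?lineC // eq_sym.
  have : rk M (z |: [set c; x; y]) <= rk M P.
    by rewrite rkS // !subUset !sub1set zP cP xP.
  rewrite rkU1 hz (_ : [set c; x; y] = y |: [set c; x]); last by rewrite setUC.
  rewrite rkU1 hy rk2 1?eq_sym // rk_cl => /leq_trans/(_ (rk3_le _ _ _ _)).
  by [].
have wH : w \in H.
  have sI : P :&: P' \subset H.
    have suv : [set u; v] \subset P :&: P' by rewrite subUset !sub1set uP.
    have h : P :&: P' \subset cl M [set u; v] by rewrite rk_le_sub_cl // rk2.
    by apply: subset_trans h _; rewrite line_sub.
  exact: subsetP sI w wP.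
by rewrite (dir_eq ay az nyz wl wH) (dir_eq ay' az' nyz' wl' wH).
Qed.

(** If the rays are coplanar, a point [w] off their plane is carried to [w'] along its own ray. The
    nonplanar case for [x, y, w] and for [x, z, w] makes the sides at [w] parallel to their images,
    and the nonplanar case for [w, y, z] concludes. *)
Lemma desargues c x y z x' y' z' : c \in C ->
  on_ray c x x' -> on_ray c y y' -> on_ray c z z' ->
  y \notin line M c x -> z \notin line M c x -> z \notin line M c y ->
  dir x y = dir x' y' -> dir x z = dir x' z' -> dir y z = dir y' z'.
Proof.
move=> cC rx ry rz hy hz hyz exy exz.
have [hz3|hz3] := boolP (z \in cl M [set c; x; y]); last first.
  exact: (desargues_nonplanar rx ry rz).
have [ax nxc ax' nx'c hx'] := rx; have [ay nyc ay' ny'c hy'] := ry.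
have [az nzc az' nz'c hz'] := rz.
have [w aw hw] : exists2 w, aff w & w \notin cl M [set c; x; y].
  apply: (@aff_outside x) => //; first exact: cl_flat.
    by apply: mem_cl; rewrite !inE eqxx ?orbT.
  by rewrite rk_cl rk3_le.
have scx : line M c x \subset cl M [set c; x; y].
  by rewrite line_sub ?cl_flat ?mem_cl // !inE eqxx ?orbT.
have wcx : w \notin line M c x by apply: contra hw; apply/subsetP.
have [w' [aw' nw'c hw' exw]] := persp_ex ax ax' aw nxc nx'c hx' wcx.
have nwc := line_neqc wcx.
have rw : on_ray c w w' by split.
have eyw := desargues_nonplanar rx ry rw hy hw exy exw.
have ezw : dir z w = dir z' w'.
  apply: (desargues_nonplanar rx rz rw) => //.
  apply: contra hw; apply/subsetP; rewrite cl_sub ?cl_flat //.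
  by rewrite !subUset !sub1set hz3 !mem_cl // !inE eqxx ?orbT.
have scy : line M c y \subset cl M [set c; x; y].
  by rewrite line_sub ?cl_flat ?mem_cl // !inE eqxx ?orbT.
have wcy : w \notin line M c y by apply: contra hw; apply/subsetP.
have scz : line M c z \subset cl M [set c; x; y].
  by rewrite line_sub ?cl_flat // mem_cl // !inE eqxx ?orbT.
have wcz : w \notin line M c z by apply: contra hw; apply/subsetP.
have ycw := line_notinC nyc wcy; have zcw := line_notinC nzc wcz.
have ewy : dir w y = dir w' y'.
  rewrite dirC // 1?eyw 1?(dirC ay') //; last exact: line_neq ycw.
  by rewrite eq_sym (line_neq (on_ray_notin rw ry ycw)).
have ewz : dir w z = dir w' z'.
  rewrite dirC // 1?ezw 1?(dirC az') //; last exact: line_neq zcw.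
  by rewrite eq_sym (line_neq (on_ray_notin rw rz zcw)).
apply: (desargues_nonplanar rw ry rz) => //.
apply: contra hw => hzw.
have := @exchange _ M w z [set c; y].
rewrite (_ : w |: [set c; y] = [set c; w; y]); last by rewrite setUCA setUA.
move=> /(_ hzw hyz); apply/subsetP; rewrite cl_sub ?cl_flat //.
by rewrite !subUset !sub1set hz3 !mem_cl // !inE eqxx ?orbT.
Qed.

Lemma off_line c p : aff p -> p != c -> exists2 q, aff q & q \notin line M c p.
Proof.
move=> ap npc; apply: (@aff_outside p) => //; first exact: cl_flat.
by rewrite rk_cl rk2 // eq_sym.
Qed.

(* Points off the line [cp] are moved by means of the pair [(p, p')], points on it by
   means of an auxiliary pair [(q, q')]; Desargues makes the two recipes agree. *)
Lemma perspectivity c p p' : c \in C -> on_ray c p p' ->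
  exists2 f : T -> T,
    [/\ f p = p' & forall x, aff x -> x != c -> on_ray c x (f x)] &
    forall x y, aff x -> x != c -> aff y -> y != c -> x != y ->
      f x != f y /\ dir (f x) (f y) = dir x y.
Proof.
move=> cC rp; have [ap npc ap' np'c hp'] := rp.
have [q aq hq] := off_line ap npc.
have nqc := line_neqc hq.
have [q' [aq' nq'c hq' epq]] := persp_ex ap ap' aq npc np'c hp' hq.
have rq : on_ray c q q' by split.
have hpq := line_notinC npc hq.
have nqp := line_neq hpq.
have nqp' := line_neq (on_ray_notin rq rp hpq).
have eqp : dir q p = dir q' p' by rewrite dirC // epq dirC // eq_sym.
have [f Hf] : exists f : T -> T, forall x, aff x -> x != c ->
    on_ray c x (f x) /\ (if x \in line M c p then dir q x = dir q' (f x)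
                         else dir p x = dir p' (f x)).
  pose Q x x' := aff x -> x != c ->
    on_ray c x x' /\ (if x \in line M c p then dir q x = dir q' x'
                         else dir p x = dir p' x').
  apply: (@fin_all_exists T (fun _ => T) Q) => x; rewrite /Q.
  have [ax|_] := boolP (aff x); last by exists x.
  have [_|nxc] := eqVneq x c; first by exists x.
  have [hx|hx] := boolP (x \in line M c p).
    have hxq : x \notin line M c q.
      by apply: contra hpq => hxq; rewrite -(line_exchange simpleM hxq nxc)
        (line_exchange simpleM hx nxc).
    have [x' [ax' nx'c hx' e]] := persp_ex aq aq' ax nqc nq'c hq' hxq.
    by exists x'.
  have [x' [ax' nx'c hx' e]] := persp_ex ap ap' ax npc np'c hp' hx.
  by exists x'.
have ray x : aff x -> x != c -> on_ray c x (f x) by move=> ax nxc; case: (Hf x ax nxc).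
have fp : f p = p'.
  have [rfp] := Hf p ap npc; rewrite line_r => e; have [_ _ afp _ hfp] := rfp.
  symmetry; apply: (@persp_uniq c p q') => //; last by rewrite -e.
  by rewrite -(on_ray_line rp); apply: on_ray_notin rp rq hq.
have off x : aff x -> x != c -> x \notin line M c p -> dir p x = dir p' (f x).
  by move=> ax nxc hx; have [_] := Hf x ax nxc; rewrite (negPf hx).
have sym x y : aff x -> x != c -> aff y -> y != c -> y \notin line M c x ->
    dir x y = dir (f x) (f y) -> dir y x = dir (f y) (f x).
  move=> ax nxc ay nyc hy e.
  have [_ _ afx _ _] := ray x ax nxc; have [_ _ afy _ _] := ray y ay nyc.
  rewrite dirC // ?e 1?dirC //; last by rewrite eq_sym (line_neq hy).
  by rewrite (line_neq (on_ray_notin (ray x ax nxc) (ray y ay nyc) hy)).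
have fq : f q = q'.
  have [rfq] := Hf q aq nqc; rewrite (negPf hq) => e; have [_ _ afq _ hfq] := rfq.
  symmetry; apply: (@persp_uniq c q p') => //; last by rewrite -e.
  by rewrite -(on_ray_line rq); apply: on_ray_notin rq rp hpq.
have offoff x y : aff x -> x != c -> aff y -> y != c -> y \notin line M c x ->
    x \notin line M c p -> y \notin line M c p -> dir x y = dir (f x) (f y).
  move=> ax nxc ay nyc hyx hx hy.
  by apply: (desargues cC rp (ray x ax nxc) (ray y ay nyc)); rewrite ?off.
have onp x : aff x -> x != c -> x \in line M c p -> line M c x = line M c p.
  by move=> ax nxc hx; apply: line_exchange.
have onq x : aff x -> x != c -> x \in line M c p -> dir q x = dir (f q) (f x).
  by move=> ax nxc hx; have [_] := Hf x ax nxc; rewrite hx fq.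
(* Desargues for the triangle [q, x, y]: the side [q x] is parallel to its image by construction,
   the side [q y] because both ends are off the line [c p]. *)
have onoff1 x y : aff x -> x != c -> aff y -> y != c -> x \in line M c p ->
    y \notin line M c p -> y \notin line M c q -> dir x y = dir (f x) (f y).
  move=> ax nxc ay nyc hx hy hyq.
  have hxq : x \notin line M c q.
    by apply: (line_notinC nxc); rewrite onp.
  apply: (desargues cC (ray q aq nqc) (ray x ax nxc) (ray y ay nyc)) => //.
  - by rewrite onp.
  - exact: onq.
  - exact: offoff.
have onoff x y : aff x -> x != c -> aff y -> y != c -> x \in line M c p ->
    y \notin line M c p -> dir x y = dir (f x) (f y).
  move=> ax nxc ay nyc hx hy.
  have [hyq|hyq] := boolP (y \in line M c q); last exact: onoff1.
  (* With [y] on the ray [c q], the points [q] and [y] span no triangle with [x]; a point [r] off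
     the plane takes the place of [q]. *)
  have [r ar hr] : exists2 r, aff r & r \notin cl M [set c; p; q].
    apply: (@aff_outside p) => //; first exact: cl_flat.
      by apply: mem_cl; rewrite !inE eqxx ?orbT.
    by rewrite rk_cl rk3_le.
  have hrp : r \notin line M c p.
    apply: contra hr; apply/subsetP.
    by rewrite line_sub ?cl_flat ?mem_cl // !inE eqxx ?orbT.
  have hrq : r \notin line M c q.
    apply: contra hr; apply/subsetP.
    by rewrite line_sub ?cl_flat ?mem_cl // !inE eqxx ?orbT.
  have nrc := line_neqc hrp.
  have eyq : line M c y = line M c q by apply: line_exchange.
  have hrx : r \notin line M c x by rewrite onp.
  have hry : r \notin line M c y by rewrite eyq.
  have exr : dir x r = dir (f x) (f r) by apply: onoff1.
  have eyr : dir y r = dir (f y) (f r) by apply: offoff.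
  apply: (desargues cC (ray r ar nrc) (ray x ax nxc) (ray y ay nyc)).
  - exact: line_notinC.
  - exact: line_notinC.
  - by rewrite onp.
  - exact: sym.
  - exact: sym.
have noncol x y : aff x -> x != c -> aff y -> y != c -> y \notin line M c x ->
    dir x y = dir (f x) (f y).
  move=> ax nxc ay nyc hyx.
  have [hx|hx] := boolP (x \in line M c p); have [hy|hy] := boolP (y \in line M c p).
  - by rewrite onp ?hy in hyx.
  - exact: onoff.
  - by apply: sym => //; [apply: line_notinC | apply: onoff].
  - exact: offoff.
exists f => // x y ax nxc ay nyc nxy.
have rx := ray x ax nxc; have ry := ray y ay nyc.
have [_ _ afx _ hfx] := rx; have [_ _ afy _ hfy] := ry.
have [hy|hy] := boolP (y \in line M c x); last first.
  by rewrite (noncol x y) ?(line_neq (on_ray_notin rx ry hy)).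
have exy : line M c y = line M c x by apply: line_exchange.
(* On a common ray the direction is preserved for free. Only injectivity remains, and it is seen
   from a point [r] off the ray. *)
have [r ar hr] := off_line ax nxc; have nrc := line_neqc hr.
have [_ _ afr _ _] := ray r ar nrc.
have nf : f x != f y.
  apply: contraNneq nxy => efxy; apply/eqP.
  apply: (@persp_uniq c x r) => //.
  rewrite (noncol r x) ?(line_notinC nxc) // (noncol r y) ?efxy //.
  by rewrite (line_notinC nyc) // exy.
split=> //; apply: line_dir => //.
have ncx : c != x by rewrite eq_sym.
have hfy' : f y \in line M c x by rewrite -exy.
by rewrite (line_eq simpleM ncx nf) // (line_eq simpleM ncx nxy) // line_r.
Qed.

(** * Hyperplanes as zero sets of affine functions *)

Section AffinePolar.
Local Notation A := {x : T | aff x}.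
Definition sdir (a b : A) : T := dir (val a) (val b).
Variables (F : fieldType) (f : A -> F).
Hypothesis f_ratio : forall a b x y : A, a != b -> x != y -> sdir a b = sdir x y ->
  exists t, (f b - f a = t * (f y - f x))%R.
Hypothesis f_onto : forall (a b : A) (t : F), a != b ->
  exists2 c : A, (f c - f a = t * (f b - f a))%R & (c == a) || (sdir a c == sdir a b).
Implicit Types (a b d : A).

(** The projective closure of the affine hyperplane [f = 0]. By [f_ratio], the level pair witnessing
    a point at infinity may be any pair in that direction. A nonzero constant [f] gives [H]
    itself. *)
Definition zero_set : {set T} :=
  [set x in C | if x \in H then
       [exists a : A, exists b : A, [&& a != b, sdir a b == x & f a == f b]]
     else [exists a : A, (val a == x) && (f a == 0%R)]].

Lemma zero_aff a : (val a \in zero_set) = (f a == 0%R).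
Proof.
rewrite inE (affC (valP a)) (negPf (affH (valP a))) /=.
apply/existsP/idP => [[b /andP[/eqP/val_inj->]]//|fa0].
by exists a; rewrite eqxx.
Qed.

Lemma sdir_in a b : a != b -> sdir a b \in H /\ sdir a b \in line M (val a) (val b).
Proof. by move=> nab; apply: dir_in; rewrite ?(valP a) ?(valP b). Qed.

Lemma sdir_eq a b h : a != b -> h \in line M (val a) (val b) -> h \in H -> sdir a b = h.
Proof. by move=> nab; apply: dir_eq; rewrite ?(valP a) ?(valP b). Qed.

Lemma zero_dir a b : a != b -> (sdir a b \in zero_set) = (f a == f b).
Proof.
move=> nab; have [hH hl] := sdir_in nab.
rewrite inE (subsetP sHC _ hH) hH /=; apply/idP/idP => [|fab].
  case/existsP=> x /existsP[y /and3P[nxy /eqP e /eqP fxy]].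
  have [t] := f_ratio nab nxy (esym e).
  by rewrite fxy GRing.subrr GRing.mulr0 => /eqP; rewrite GRing.subr_eq0 eq_sym.
by apply/existsP; exists a; apply/existsP; exists b; rewrite nab eqxx.
Qed.

Lemma aff_or_H x : x \in C -> x \in H \/ exists a : A, val a = x.
Proof.
move=> xC; have [xH|xH] := boolP (x \in H); [by left | right].
have ax : aff x by rewrite /aff xC.
by exists (exist _ x ax).
Qed.

Lemma sdir_third a h : h \in H -> exists b,
  [/\ a != b, sdir a b = h & line M (val a) h = line M (val a) (val b)].
Proof.
move=> hH; have [y [ay nay dy]] := aff_third (valP a) hH.
exists (exist _ y ay); split=> //.
by rewrite -dy dir_line // (valP a).
Qed.

Lemma zero_closed (o : A) x y z : x \in zero_set -> y \in zero_set -> x != y ->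
  z \in line M x y -> z \in zero_set.
Proof.
have affaff a b w : val a \in zero_set -> val b \in zero_set -> a != b ->
    w \in line M (val a) (val b) -> w \in zero_set.
  rewrite !zero_aff => /eqP fa /eqP fb nab wl.
  have wC : w \in C by apply: line_in wl; rewrite ?(affC (valP _)).
  have [wH|[c ec]] := aff_or_H wC.
    by rewrite -(sdir_eq nab wl wH) zero_dir // fa fb.
  rewrite -ec zero_aff; have [->|nac] := eqVneq c a; first by rewrite fa.
  have nac' : a != c by rewrite eq_sym.
  have e : sdir a c = sdir a b.
    have [dH dl] := sdir_in nac'; symmetry; apply: sdir_eq => //.
    by rewrite -(line_exchange simpleM wl) -?ec.
  have [t] := f_ratio nac' nab e.
  by rewrite fa fb GRing.subrr GRing.mulr0 GRing.subr0 => ->.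
have affH' a h w : val a \in zero_set -> h \in zero_set -> h \in H ->
    w \in line M (val a) h -> w \in zero_set.
  move=> az hz hH; have [b [nab dab ->]] := sdir_third a hH; apply: affaff => //.
  by move: hz az; rewrite -dab zero_dir // !zero_aff => /eqP->.
move=> xz yz nxy zl.
have xC : x \in C by move: xz; rewrite inE => /andP[].
have yC : y \in C by move: yz; rewrite inE => /andP[].
have [xH|[a ea]] := aff_or_H xC; have [yH|[b eb]] := aff_or_H yC; last first.
- by rewrite -ea -eb in xz yz nxy zl; apply: affaff zl.
- by rewrite -ea in xz zl; apply: affH' zl.
- by rewrite -eb in yz zl; rewrite lineC in zl; apply: affH' zl.
have zH : z \in H by apply: line_in zl.
have [->//|nzx] := eqVneq z x; have [->//|nzy] := eqVneq z y.
(* Three collinear points at infinity are realised as the side directions of an affine triangle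
   [o, b, p]. As [f] is constant along the sides in directions [x] and [y], it is constant along the
   third. *)
have [b [nob dob lob]] := sdir_third o xH.
have nox := aff_neqH (valP o) xH; have noz := aff_neqH (valP o) zH.
have nby := aff_neqH (valP b) yH.
have [|w wl wl'] := @veblen _ M simpleM modularM x (val o) z (val b) y noz nby _
    (line_rot simpleM zl nzx).
  by rewrite lineC lob line_r.
have wC : w \in C := line_in flatC (affC (valP o)) (subsetP sHC _ zH) wl.
have [wH|[p ep]] := aff_or_H wC.
  case/eqP: nzy.
  rewrite -(line_H_eq (valP o) wl (line_r _ _ _) wH zH).
  exact: (line_H_eq (valP b) wl' (line_r _ _ _) wH yH).
rewrite -ep in wl wl'.
have npb : b != p.
  apply: contraNneq nzx => ebp; rewrite -ebp in wl.
  by rewrite -dob (sdir_eq nob (line_rot simpleM wl _) zH) ?(inj_eq val_inj) // eq_sym.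
have npo : o != p.
  apply: contraNneq nxy => eop; rewrite -eop in wl'.
  have nbo : b != o by rewrite eq_sym.
  rewrite -dob -(sdir_eq nbo (line_rot simpleM wl' _) yH) ?(inj_eq val_inj) //.
  by rewrite /sdir dirC ?(valP o) ?(valP b).
have dop : sdir o p = z.
  by apply: sdir_eq; rewrite // (line_rot simpleM wl) // (inj_eq val_inj) eq_sym.
have dbp : sdir b p = y.
  by apply: sdir_eq; rewrite // (line_rot simpleM wl') // (inj_eq val_inj) eq_sym.
move: xz yz; rewrite -dob zero_dir // -dbp zero_dir // => /eqP fob /eqP fbp.
by rewrite -dop zero_dir // fob fbp.
Qed.

Lemma zero_meet (o : A) x y : x \in C -> y \in C -> x != y ->
  exists2 z, z \in line M x y & z \in zero_set.
Proof.
have affaff a b : a != b -> exists2 z, z \in line M (val a) (val b) & z \in zero_set.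
  move=> nab; have [dH dl] := sdir_in nab.
  have [e|ne] := eqVneq (f a) (f b).
    by exists (sdir a b) => //; rewrite zero_dir // e.
  have ne' : (f b - f a != 0)%R by rewrite GRing.subr_eq0 eq_sym.
  have [c fc hc] := f_onto (- f a / (f b - f a))%R nab.
  exists (val c).
    case/orP: hc => [/eqP->|/eqP hc]; first exact: line_l.
    have [->|nac] := eqVneq a c; first exact: line_l.
    by apply: dir_on_line; rewrite ?(valP _).
  rewrite zero_aff; apply/eqP; move: fc; rewrite GRing.divfK // => /eqP.
  by rewrite GRing.subr_eq GRing.addNr => /eqP.
move=> xC yC nxy.
have [xH|[a ea]] := aff_or_H xC; have [yH|[b eb]] := aff_or_H yC; last first.
- by rewrite -ea -eb in nxy *; apply: affaff.
- by have [b [nab _ e]] := sdir_third a yH; rewrite -ea e; apply: affaff.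
- by have [a [nab _ e]] := sdir_third b xH; rewrite -eb lineC e; apply: affaff.
have [a [noa doa loa]] := sdir_third o xH; have [b [nob dob lob]] := sdir_third o yH.
have [fao|nfao] := eqVneq (f o) (f a).
  by exists x; [apply: line_l | rewrite -doa zero_dir // fao].
have ne' : (f a - f o != 0)%R by rewrite GRing.subr_eq0 eq_sym.
(* [c] is the point of the line [o a] at the level of [b], so the line [c b] is level and its point
   at infinity, which lies on the line [x y], is a zero. *)
have [c fc hc] := f_onto ((f b - f o) / (f a - f o))%R noa.
have {fc} fcb : f c = f b.
  by apply: (GRing.addIr (- f o)%R); rewrite fc GRing.divfK.
have [eco|nco] := eqVneq c o.
  by exists y; [apply: line_r | rewrite -dob zero_dir // -fcb eco].
rewrite (negPf nco) /= doa in hc; have noc : o != c by rewrite eq_sym.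
have ncb : c != b by apply: contraNneq nxy => ecb; rewrite -(eqP hc) ecb dob.
have [wH wl] := sdir_in ncb.
have hcx : val c \in line M (val o) x.
  by rewrite -(eqP hc) /sdir dir_line ?(valP _) // line_r.
have hby : val b \in line M (val o) y by rewrite lob line_r.
have [w wxy wcb] := veblen simpleM modularM nxy (ncb : val c != val b) hcx hby.
exists w => //; have wH' : w \in H by apply: line_in wxy.
by rewrite -(sdir_eq ncb wcb wH') zero_dir // fcb.
Qed.
End AffinePolar.

(** * Translations, homotheties and the polarity *)

Section AffineSpace.
Local Notation A := {x : T | aff x}.
Implicit Types (a b d o : A).

Lemma sdirC a b : a != b -> sdir a b = sdir b a.
Proof. by move=> nab; apply: dirC; rewrite ?(valP a) ?(valP b). Qed.

Lemma sdirT a b d : a != b -> a != d -> b != d -> sdir a b = sdir a d ->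
  sdir b d = sdir a b.
Proof. by move=> nab nad nbd; apply: dir_trans; rewrite ?(valP a) ?(valP b) ?(valP d). Qed.

Lemma sdir2 a p : exists2 b, a != b & sdir a b != p.
Proof.
have [w aw hw] : exists2 w, aff w & w \notin line M (val a) p.
  apply: (@aff_outside (val a)); rewrite ?(valP a) ?cl_flat ?line_l // rk_cl.
  by apply: leq_trans (rk_card _ _) _; rewrite cards2; case: (_ != _).
have naw : val a != w by apply: contraNneq hw => <-; apply: line_l.
exists (exist _ w aw) => //; apply: contra hw => /eqP <-.
by rewrite /sdir dir_line ?(valP a) // line_r.
Qed.

(** An affine centre is added as a fixed point; for a centre in [H] the last clause is vacuous. *)
Lemma sperspectivity c a b : c \in C -> on_ray c (val a) (val b) ->
  exists g : A -> A, [/\ g a = b,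
    forall x : A, val x != c -> on_ray c (val x) (val (g x)),
    forall x y : A, val x != c -> val y != c -> x != y ->
      g x != g y /\ sdir (g x) (g y) = sdir x y & forall x : A, val x = c -> g x = x].
Proof.
move=> cC rab; have [f [fa fr] fd] := perspectivity cC rab.
have [g hg] : exists g : A -> A, forall x : A,
    if val x == c then g x = x else val (g x) = f (val x).
  apply: (@fin_all_exists A (fun _ => A)
    (fun x y : A => if val x == c then y = x else val y = f (val x))) => x.
  case: eqVneq => [_|nx]; first by exists x.
  by have [_ _ ax _ _] := fr _ (valP x) nx; exists (exist _ (f (val x)) ax).
have gE (x : A) : val x != c -> val (g x) = f (val x).
  by move=> nx; have := hg x; rewrite (negPf nx).
have [_ nac _ _ _] := rab.
exists g; split.
- by apply: val_inj; rewrite gE.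
- by move=> x nx; rewrite gE //; apply: fr; rewrite // (valP x).
- move=> x y nx ny nxy; have [n e] := fd _ _ (valP x) nx (valP y) ny nxy.
  by rewrite -(inj_eq val_inj) /sdir !gE.
- by move=> x ex; have := hg x; rewrite ex eqxx.
Qed.

(** The perspectivity is centred at the point at infinity of [a b]; the work is to exclude fixed
    points. A fixed point off the line [a b] would see [a] and [b] in the same direction. A fixed
    point on that line would force points off it to be fixed. *)
Lemma stransl_ex a b : a != b -> exists t,
  [/\ dilatation sdir t, t a = b & moves_along sdir t (sdir a b)].
Proof.
move=> nab; have [cH cl] := sdir_in nab; set c := sdir a b in cH cl *.
have nA (x : A) : val x != c by apply: aff_neqH; rewrite ?(valP x).
have bl : val b \in line M c (val a).
  rewrite lineC; apply: (line_rot simpleM cl).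
  by rewrite eq_sym.
have rab : on_ray c (val a) (val b) by split; rewrite ?(valP a) ?(valP b) ?nA.
have [g [ga gr gd _]] := sperspectivity (subsetP sHC _ cH) rab.
have dg : dilatation sdir g by move=> x y nxy; apply: gd.
have nofix (x : A) : val x \notin line M c (val a) -> x != g x.
  move=> hx; apply/eqP => ex; have nax : a != x.
    by rewrite -(inj_eq val_inj); apply: line_neq hx.
  have [n e] := dg _ _ nax; rewrite ga -ex in n e.
  have nxa : x != a by rewrite eq_sym.
  have nxb : x != b by rewrite eq_sym.
  have bxa : val b \in line M (val x) (val a).
    by apply: dir_on_line; rewrite ?(valP _) //; rewrite -!/(sdir _ _) sdirC // -e sdirC.
  have nca : c != val a by rewrite eq_sym nA.
  case/negP: hx; rewrite -(line_eq simpleM nca nab (line_r _ _ _) bl).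
  by rewrite (line_exchange simpleM (y := val x)) ?line_r // 1?lineC // eq_sym.
have nofix' (x : A) : x != g x.
  have [hx|] := boolP (val x \in line M c (val a)); last exact: nofix.
  have [r ar hr] := off_line (valP a) (nA a); pose r' : A := exist _ r ar.
  have := nofix r' hr; apply: contraNneq => ex.
  have exa := line_exchange simpleM hx (nA x).
  have hr' : val r' \notin line M c (val x) by rewrite exa.
  have nxr : x != r' by rewrite -(inj_eq val_inj); apply: line_neq hr'.
  have [_ e] := dg _ _ nxr; rewrite -ex in e.
  have [_ _ _ _ hgr] := gr _ (nA r').
  apply/eqP/val_inj.
  apply: (@persp_uniq c (val r') (val x)); rewrite ?(valP _) ?line_r //.
  by apply: line_notinC; rewrite ?nA.
exists g; split=> // x; split=> //; apply: sdir_eq => //.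
have [_ _ _ _ hgx] := gr _ (nA x); rewrite lineC in hgx.
by apply: (line_rot simpleM hgx); rewrite (inj_eq val_inj) eq_sym.
Qed.

(** The centre is [o] itself, about which [perspectivity] says nothing; directions from [o] are kept
    because every ray is mapped into itself. *)
Lemma shomoth_ex o a b : o != a -> o != b -> sdir o a = sdir o b ->
  exists f, [/\ dilatation sdir f, f o = o & f a = b].
Proof.
move=> noa nob e.
have rab : on_ray (val o) (val a) (val b).
  split; rewrite ?(valP a) ?(valP b) // 1?eq_sym //.
  by apply: dir_on_line; rewrite ?(valP _).
have [g [ga gr gd go]] := sperspectivity (affC (valP o)) rab.
exists g; split=> //; last exact: go.
have god (y : A) : o != y -> g o != g y /\ sdir (g o) (g y) = sdir o y.
  move=> noy; have ny : val y != val o by rewrite eq_sym.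
  rewrite (go o) //; have ry := gr y ny; have [_ _ agy ngy hgy] := ry.
  have nogy : o != g y by rewrite eq_sym.
  split=> //; apply: line_dir; rewrite ?(valP _) //.
  exact: on_ray_line ry.
move=> x y nxy; have [exo|nxo] := eqVneq x o; first by rewrite exo in nxy *; apply: god.
have [eyo|nyo] := eqVneq y o; last exact: gd.
rewrite eyo in nxy *; have nox : o != x by rewrite eq_sym.
have [n ed] := god x nox; rewrite eq_sym.
by split=> //; rewrite sdirC 1?eq_sym // ed sdirC.
Qed.

(* The polarity is the standard dot product on the coordinates [(phi a, 1)] of an affine
   point [a] and [(phi b, 0)] of a point at infinity [dir o b]; [zero_set (f x)] is the
   polar hyperplane of [x]. *)
Local Open Scope ring_scope.

Lemma affine_polar (o : A) : exists R : rel T, polarity_on M C R.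
Proof.
have [F [n [phi [[psi phiK psiK] phi0 phiP]]]] :=
  affine_coord sdirC sdirT sdir2 stransl_ex shomoth_ex o.
have [rep Hrep] : exists rep : T -> A, forall x, x \in C ->
    if x \in H then o != rep x /\ sdir o (rep x) = x else val (rep x) = x.
  pose Q (x : T) (r : A) := x \in C ->
    if x \in H then o != r /\ sdir o r = x else val r = x.
  apply: (@fin_all_exists T (fun _ => A) Q) => x; rewrite /Q.
  have [xC|_] := boolP (x \in C); last by exists o.
  have [xH|[a ea]] := aff_or_H xC.
    by have [b [nb db _]] := sdir_third o xH; exists b; rewrite xH.
  by exists a; rewrite -ea (negPf (affH (valP a))).
pose dot (u v : 'rV[F]_n) : F := \sum_i u 0 i * v 0 i.
(* Commutativity of [F] is what makes the polarity symmetric. *)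
have dotC (u v : 'rV[F]_n) : dot u v = dot v u by apply: eq_bigr => i _; rewrite mulrC.
have dotB (u v w : 'rV[F]_n) : dot u (v - w) = dot u v - dot u w.
  by rewrite -sumrB; apply: eq_bigr => i _; rewrite !mxE mulrBr.
have dotZ (u v : 'rV[F]_n) t : dot u (t *: v) = t * dot u v.
  by rewrite mulr_sumr; apply: eq_bigr => i _; rewrite mxE mulrCA.
have dot0 (u : 'rV[F]_n) : dot u 0 = 0 by apply: big1 => i _; rewrite mxE mulr0.
pose k x : F := if x \in H then 0 else 1.
pose f x a := dot (phi (rep x)) (phi a) + k x.
have fB x a b : f x b - f x a = dot (phi (rep x)) (phi b - phi a).
  by rewrite dotB /f opprD addrACA subrr addr0.
have f_ratio x (a b c d : A) : a != b -> c != d -> sdir a b = sdir c d ->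
    exists t, f x b - f x a = t * (f x d - f x c).
  move=> nab ncd e; have /phiP [] := esym e => //.
  by move=> t et; exists t; rewrite !fB et dotZ.
have f_onto x (a b : A) (t : F) : a != b ->
    exists2 c : A, f x c - f x a = t * (f x b - f x a) & (c == a) || (sdir a c == sdir a b).
  move=> nab; exists (psi (t *: (phi b - phi a) + phi a)).
    by rewrite !fB psiK addrK dotZ.
  case: eqVneq => //= nca; apply/eqP; symmetry; rewrite phiP // 1?eq_sym //.
  by exists t; rewrite psiK addrK.
(* With [k] as the last homogeneous coordinate, lying on the polar becomes a condition symmetric in
   [x] and [y]. *)
have pol x y : x \in C -> y \in C -> (y \in zero_set (f x)) =
    (dot (phi (rep x)) (phi (rep y)) + k x * k y == 0).
  move=> xC yC; have := Hrep y yC; rewrite /k; case: ifP => yH.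
    case=> noy ey; rewrite -[in LHS]ey (zero_dir (f_ratio x)) // /f phi0 dot0 add0r mulr0 addr0.
    by rewrite -subr_eq0 opprD addrCA subrr addr0 oppr_eq0.
  by move=> ey; rewrite -{1}ey zero_aff /f mulr1.
exists (fun x y : T => y \in zero_set (f x)); split.
- by move=> x y xC yC; rewrite !pol // dotC mulrC.
- move=> x xC.
  (* The form is nondegenerate: a point at infinity has a nonzero coordinate vector, detected by a
     unit vector, while for an affine [x] the origin has value 1. *)
  have [a fa] : exists a, f x a != 0.
    have := Hrep x xC; case: ifP => xH.
      case=> nox _; have [e|nz] := eqVneq (phi (rep x)) 0.
        by case/eqP: nox; apply: (can_inj phiK); rewrite phi0 e.
      have [i ni] : exists i, phi (rep x) 0 i != 0.
        apply/existsP; apply: contraT => /existsPn h.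
        by case/eqP: nz; apply/rowP=> i; have := h i; rewrite mxE negbK => /eqP.
      exists (psi (delta_mx 0 i)); rewrite /f psiK /k xH addr0 /dot.
      rewrite (bigD1 i) //= mxE !eqxx mulr1 big1 ?addr0 // => j nj.
      by rewrite mxE (negPf nj) andbF mulr0.
    by move=> _; exists o; rewrite /f phi0 dot0 /k xH add0r oner_eq0.
  by exists (val a); [apply: affC (valP a) | rewrite zero_aff].
- move=> x y z w xC yC zC nyz Ry Rz wl.
  exact: (zero_closed (f_ratio x) o Ry Rz nyz wl).
- move=> x y z xC yC zC nyz.
  exact: (zero_meet (f_ratio x) (f_onto x) o yC zC nyz).
Qed.
End AffineSpace.
End Desargues.

(** * Components *)

Section Components.
Variables (T : finType) (M : matroid T).
Hypotheses (simpleM : simple_matroid M) (modularM : modular M).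
Implicit Types (x y z w : T) (C H : {set T}).

(** For a maximal proper subflat [H], adding any point outside it spans [C], so the rank of [C]
    exceeds that of [H] by at most 1 and a line cannot avoid [H]. *)
Lemma hyperplane_meet C : is_flat M C -> C != set0 ->
  exists H, [/\ is_flat M H, H \proper C &
    forall x y, x \in C -> y \in C -> x != y -> exists2 h, h \in H & h \in line M x y].
Proof.
move=> fC /set0Pn[o oC].
pose P (F : {set T}) := is_flat M F && (F \proper C).
have P0 : P (cl M set0).
  rewrite /P cl_flat properE cl_sub // sub0set /=.
  apply/subsetPn; exists o => //; rewrite inE setU0 rk1 //.
  by have := rk_card M set0; rewrite cards0 leqn0 => /eqP->.
have [H /maxsetP[/andP[fH pH] maxH] _] := maxset_exists P0.
exists H; split=> // x y xC yC nxy.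
have [yH|yH] := boolP (y \in H); first by exists y => //; apply: line_r.
have [|||h hl hH] := @meet_point _ M modularM (line M x y) H; rewrite ?cl_flat //; last by exists h.
rewrite rk_cl rk2 //; apply: (@leq_ltn_trans (rk M H).+1) => //.
have eC : cl M (y |: H) = C.
  apply/eqP; apply: contraT => neC.
  have sF : H \subset cl M (y |: H) := subset_trans (subsetUr _ _) (sub_cl _ _).
  have PF : P (cl M (y |: H)).
    rewrite /P cl_flat properEneq neC cl_sub // subUset sub1set yC.
    by rewrite (proper_sub pH).
  by case/negP: yH; rewrite -(maxH _ PF sF) mem_cl // !inE eqxx.
apply: (@leq_trans (rk M C)).
  by rewrite rkS // subUset (proper_sub pH) andbT line_sub.
by rewrite -eC rk_cl rkU1 (eqP fH) yH addn1.
Qed.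

Lemma component_polar C : is_flat M C -> C != set0 -> rk M C <> 3 ->
  (forall x y, x \in C -> y \in C -> x != y ->
    exists z, [/\ z \in line M x y, z != x & z != y]) ->
  exists R : rel T, polarity_on M C R.
Proof.
move=> fC nC rC third.
have rk_pair x y : x \in C -> y \in C -> x != y -> 2 <= rk M C.
  by move=> xC yC nxy; rewrite -(rk2 simpleM nxy) rkS // subUset !sub1set xC.
have [r1|r2] := leqP (rk M C) 1.
  (* A single point: its hyperplane is the empty set. *)
  exists (fun _ _ => false); split=> //.
    by move=> x xC; exists x.
  by move=> x y z xC yC zC /(rk_pair _ _ yC zC); rewrite leqNgt ltnS r1.
have [r2'|r3] := leqP (rk M C) 2.
  (* A single line: hyperplanes are points, and each point is its own polar. *)
  exists (fun x y => x == y); split.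
  - by move=> x y _ _; apply: eq_sym.
  - move=> x xC; have /subsetPn[y yC hy] : ~~ (C \subset [set x]).
      by apply: contraL r2 => /(rkS M); rewrite rk1 // -leqNgt.
    by exists y => //; rewrite inE in hy; rewrite eq_sym.
  - by move=> x y z w _ _ _ nyz /eqP exy /eqP exz; rewrite -exy -exz eqxx in nyz.
  - move=> x y z xC yC zC nyz; exists x => //.
    have sC : C \subset line M y z.
      by rewrite rk_le_sub_cl ?rk2 // subUset !sub1set yC.
    exact: subsetP sC x xC.
have r4 : 3 < rk M C by lia.
have [H [fH pH meetH]] := hyperplane_meet fC nC.
have [sHC /subsetPn[o oC oH]] := andP pH.
have ao : aff C H o by rewrite /aff oC.
exact: (affine_polar simpleM modularM fC fH sHC third meetH r4 (exist _ o ao)).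
Qed.

(** Perspectivity of atoms in the modular lattice of flats: a third point on the line is a common
    complement of [x] and [y] in it. *)
Definition linked x y :=
  (x == y) || [exists z, [&& z \in line M x y, z != x & z != y]].

Lemma linkedP x y : x != y ->
  reflect (exists z, [/\ z \in line M x y, z != x & z != y]) (linked x y).
Proof.
move=> nxy; rewrite /linked (negPf nxy).
by apply: (iffP existsP) => -[z]; [case/and3P | case]; exists z => //; apply/and3P.
Qed.

Lemma linkedC : symmetric linked.
Proof.
move=> x y; rewrite /linked eq_sym lineC; congr (_ || _).
by apply: eq_existsb => z; rewrite [(z != x) && _]andbC.
Qed.

Lemma linked_third x y z : z \in line M x y -> z != x -> z != y -> x != y -> linked x z.
Proof.
move=> zl nzx nzy nxy; apply/linkedP; first by rewrite eq_sym.
by exists y; split; [exact: (line_rot simpleM zl nzx) | rewrite eq_sym | rewrite eq_sym].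
Qed.

(* For [a] on [xy] and [b] on [yz], the coplanar lines [ab] and [xz] meet. *)
Lemma linked_trans x y z : linked x y -> linked y z -> linked x z.
Proof.
have [<-//|nxy] := eqVneq x y; have [<-//|nyz] := eqVneq y z.
have [<-|nxz] := eqVneq x z; first by rewrite /linked eqxx.
move=> /(linkedP nxy)[a [al nax nay]] /(linkedP nyz)[b [bl nby nbz]].
apply/linkedP => //.
have [yl|yl] := boolP (y \in line M x z).
  by exists y; split; rewrite // eq_sym.
have yx : a \in line M y x by rewrite lineC.
have exa : line M y a = line M y x := line_exchange simpleM yx nay.
have ezb : line M y b = line M y z := line_exchange simpleM bl nby.
have nyx : y != x by rewrite eq_sym.
have zyx : z \notin line M y x.
  by apply: contra yl => h; rewrite (line_rot simpleM) 1?eq_sym // lineC.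
have nab : a != b.
  apply: contraNneq zyx => eab; rewrite -exa eab ezb; exact: line_r.
have [d dl dl'] := veblen simpleM modularM nxz nab yx bl.
exists d; split=> //.
  apply: contraNneq zyx => edx; rewrite edx in dl'.
  have := line_rot simpleM dl' _; rewrite eq_sym => /(_ nax) h.
  have : b \in line M y x by apply: line_in h; rewrite ?cl_flat ?line_r.
  by move=> h'; rewrite -(line_exchange simpleM h' nby) ezb line_r.
apply: contraNneq zyx => edz; rewrite edz lineC in dl'.
have := line_rot simpleM dl' _; rewrite eq_sym => /(_ nbz) h.
have hx : a \in line M y z.
  by apply: line_in h; rewrite ?cl_flat ?line_r.
by rewrite -exa (line_exchange simpleM hx nay) line_r.
Qed.

(** For a circuit [K] through [x] and [y], the line [x y] and the span of the rest [Z] have ranks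
    adding up to [#|K|] inside a flat of smaller rank, so they meet; the meeting point is neither
    [x] nor [y], which are outside the span of [Z]. Conversely, three collinear points form a
    circuit. *)
Lemma same_componentE x y : same_component M x y = linked x y.
Proof.
rewrite /same_component; have [->|nxy] := eqVneq x y; first by rewrite /linked eqxx.
apply/existsP/(linkedP nxy) => [[K /and3P[cK xK yK]]|[z [zl nzx nzy]]].
  have [nK minK] := minsetP cK.
  have indK u : u \in K -> indep M (K :\ u).
    move=> uK; apply: contraT => nu; have := minK _ nu (subsetDl _ _).
    by move/setP/(_ u); rewrite !inE uK eqxx.
  pose Z := K :\ x :\ y.
  have eKy : K :\ y = x |: Z.
    apply/setP=> u; rewrite !inE; have [->|] := eqVneq u x; rewrite ?xK ?nxy //=.
  have eKx : K :\ x = y |: Z by rewrite setD1K // !inE eq_sym nxy.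
  have cZ : #|K| = #|Z|.+2.
    by rewrite (cardsD1 x) xK (cardsD1 y (K :\ x)) !inE eq_sym nxy yK.
  have rkI I : indep M I -> rk M I = #|I|.
    by move=> iI; apply/eqP; rewrite eqn_leq rk_card rk_ge.
  have rZ : rk M Z = #|Z| by rewrite rkI // (indepS _ (indK x xK)) // subsetDl.
  have xZ : x \notin Z by rewrite !inE eqxx andbF.
  have yZ : y \notin Z by rewrite !inE eqxx.
  have rxZ : x \notin cl M Z.
    have := rkU1 M x Z; rewrite -eKy rkI ?indK // eKy cardsU1 xZ rZ.
    by case: (x \notin _) => //; lia.
  have ryZ : y \notin cl M Z.
    have := rkU1 M y Z; rewrite -eKx rkI ?indK // eKx cardsU1 yZ rZ.
    by case: (y \notin _) => //; lia.
  have rK : rk M K < #|K|.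
    rewrite ltn_neqAle rk_card andbT; apply: contra nK => /eqP eK.
    have [I [sI iI eI]] := rk_basis M K.
    suff <- : I = K by [].
    by apply/eqP; rewrite eqEcard sI eI eK leqnn.
  have sxyK : [set x; y] \subset cl M K by rewrite subUset !sub1set !mem_cl.
  have sZK : Z \subset K by rewrite /Z !subDset subsetU // orbC subsetU ?subxx ?orbT.
  have [|||g gl gZ] := @meet_point _ M modularM (line M x y) (cl M Z); rewrite ?cl_flat //.
    rewrite !rk_cl rk2 // rZ (_ : 2 + _ = #|K|) ?cZ // -cZ; apply: leq_ltn_trans rK.
    by rewrite -(rk_cl M K) rkS // subUset cl_sub ?cl_flat // sxyK clS.
  exists g; split=> //.
    by apply: contraNneq rxZ => <-.
  by apply: contraNneq ryZ => <-.
exists [set x; y; z]; rewrite !inE !eqxx !orbT !andbT.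
have c3 : #|[set x; y; z]| = 3.
  by rewrite setUC cardsU1 cards2 nxy !inE negb_or nzx nzy.
apply/minsetP; split.
  apply/negP => i3; have := rk_ge (subxx _) i3; rewrite c3.
  have : rk M [set x; y; z] <= rk M (line M x y).
    by rewrite rkS // !subUset !sub1set zl line_l line_r.
  by rewrite rk_cl rk2 //; lia.
move=> B nB sB; apply/eqP; rewrite eqEsubset sB.
have sub2 u v : B \subset [set u; v] -> false.
  by move=> s; case/negP: nB; apply: indepS s _; apply: indep2.
have out u v w : w \notin B -> B \subset [set u; v; w] -> B \subset [set u; v].
  move=> nw s; apply/subsetP=> t tB; have := subsetP s t tB.
  by rewrite !inE; case/orP=> // /eqP etw; rewrite -etw tB in nw.
rewrite !subUset !sub1set -!andbA /=; apply/and3P; split.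
- by apply: contraT => /(out y z x); rewrite setUC setUA => /(_ sB)/sub2.
- by apply: contraT => /(out x z y); rewrite setUAC => /(_ sB)/sub2.
- by apply: contraT => /(out x y z)/(_ sB)/sub2.
Qed.

Definition component_of x : {set T} := [set y | linked x y].

Lemma mem_components x : component_of x \in components M.
Proof.
apply/imsetP; exists x => //; apply/setP=> y.
by rewrite !inE same_componentE.
Qed.

Lemma component_ofE x y : linked x y -> component_of x = component_of y.
Proof.
move=> lxy; apply/setP=> z; rewrite !inE; apply/idP/idP; last exact: linked_trans.
by apply: linked_trans; rewrite linkedC.
Qed.

Lemma linked_line x y z w : linked x y -> linked x z -> y != z ->
  w \in line M y z -> linked x w.
Proof.
move=> ly lz nyz wl; have [->//|nwy] := eqVneq w y; have [->//|nwz] := eqVneq w z.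
by apply: linked_trans ly _; apply: linked_third wl _ _ _.
Qed.

Lemma component_of_flat x : is_flat M (component_of x).
Proof.
by apply: line_closed_flat => // y z w; rewrite ![_ \in component_of x]inE; apply: linked_line.
Qed.

Lemma modular_polarity :
  (forall C, C \in components M -> rk M C <> 3) ->
  exists R : rel T, polarity_on M [set: T] R.
Proof.
move=> hC.
(* One relation is chosen per component, not per point, so that [x] and [y] in one component use the
   same relation. *)
have [Rc HR] : exists Rc : {set T} -> rel T,
    forall K x, K = component_of x -> polarity_on M K (Rc K).
  pose Q (K : {set T}) (R : rel T) := forall x, K = component_of x -> polarity_on M K R.
  apply: (@fin_all_exists _ (fun _ => rel T) Q) => K; rewrite /Q.
  have [/existsP[x /eqP eK]|/existsPn h] := boolP [exists x, K == component_of x]; last first.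
    by exists (fun _ _ => true) => x eK; case/eqP: (h x).
  have fK : is_flat M K by rewrite eK component_of_flat.
  have nK : K != set0 by apply/set0Pn; exists x; rewrite eK inE /linked eqxx.
  have rK : rk M K <> 3 by apply: hC; rewrite eK mem_components.
  have [y z|R HR] := component_polar fK nK rK; last by exists R.
  rewrite eK ![_ \in component_of x]inE => lxy lxz nyz; apply/linkedP => //.
  by apply: linked_trans lxz; rewrite linkedC.
(* A hyperplane of a direct sum is a hyperplane of one summand together with all the others, so
   unlinked points are conjugate. *)
pose R x y := linked x y ==> Rc (component_of x) x y.
have R_in x y : linked x y -> R x y = Rc (component_of x) x y by rewrite /R => ->.
have R_out x y : ~~ linked x y -> R x y by rewrite /R => /negPf->.
have mem x y : linked x y -> y \in component_of x by rewrite inE.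
have self x : x \in component_of x by rewrite inE /linked eqxx.
exists R; split.
- move=> x y _ _; have [lxy|nxy] := boolP (linked x y); last first.
    by rewrite !R_out // linkedC.
  have lyx : linked y x by rewrite linkedC.
  have [symR _ _ _] := HR _ x erefl.
  by rewrite !R_in // -(component_ofE lxy); apply: symR (self x) (mem _ _ lxy).
- move=> x _; have [_ hx _ _] := HR _ x erefl.
  have [y yx nR] := hx x (self x); rewrite inE in yx.
  by exists y; rewrite ?in_setT // R_in.
- move=> x y z w _ _ _ nyz Ry Rz wl.
  have [->//|nwy] := eqVneq w y; have [->//|nwz] := eqVneq w z.
  have lyw : linked y w by apply: linked_third wl nwy nwz nyz.
  have lzw : linked z w by rewrite lineC in wl; apply: linked_third wl nwz nwy _; rewrite eq_sym.
  have [lxw|/R_out//] := boolP (linked x w).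
  have lxy : linked x y by apply: linked_trans lxw _; rewrite linkedC.
  have lxz : linked x z by apply: linked_trans lxw _; rewrite linkedC.
  have [_ _ hx _] := HR _ x erefl.
  move: Ry Rz; rewrite !R_in // => Ry Rz.
  exact: hx (self x) (mem _ _ lxy) (mem _ _ lxz) nyz Ry Rz wl.
- move=> x y z _ _ _ nyz.
  have [lxy|/R_out Rxy] := boolP (linked x y); last by exists y; rewrite ?line_l.
  have [lxz|/R_out Rxz] := boolP (linked x z); last by exists z; rewrite ?line_r.
  have [_ _ _ hx] := HR _ x erefl.
  have [w wl Rw] := hx x y z (self x) (mem _ _ lxy) (mem _ _ lxz) nyz.
  by exists w; rewrite // R_in //; apply: linked_line wl.
Qed.
End Components.

(** * From a polarity to an order-reversing involution of the flats *)

Section Duality.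
Variables (T : finType) (M : matroid T).
Hypotheses (simpleM : simple_matroid M) (modularM : modular M).
Variable R : rel T.
Hypothesis polR : polarity_on M [set: T] R.
Implicit Types (x y z : T) (X Y Z : {set T}).

Definition perp X : {set T} := [set y | [forall x in X, R x y]].

Lemma perpP X y : reflect (forall x, x \in X -> R x y) (y \in perp X).
Proof. by rewrite inE; apply: forall_inP. Qed.

Lemma perp_flat X : is_flat M (perp X).
Proof.
have [_ _ closedR _] := polR.
apply: line_closed_flat => // y z w /perpP hy /perpP hz nyz wl.
by apply/perpP=> x xX; apply: closedR nyz (hy x xX) (hz x xX) wl; rewrite inE.
Qed.

Lemma perpS X Y : X \subset Y -> perp Y \subset perp X.
Proof.
by move=> sXY; apply/subsetP=> y /perpP hy; apply/perpP=> x /(subsetP sXY); apply: hy.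
Qed.

Lemma sub_perp_perp X : X \subset perp (perp X).
Proof.
have [symR _ _ _] := polR.
by apply/subsetP=> x xX; apply/perpP=> y /perpP hy; rewrite symR ?inE ?hy.
Qed.

Lemma perp_setT : perp [set: T] = set0.
Proof.
have [symR hR _ _] := polR; apply/setP=> y; rewrite in_set0; apply/negP=> /perpP hy.
have [x _] := hR y (in_setT y); rewrite symR ?inE // => /negP[].
exact: hy.
Qed.

Lemma perp_cl X : perp (cl M X) = perp X.
Proof.
apply/eqP; rewrite eqEsubset perpS ?sub_cl //=.
have h : cl M X \subset perp (perp X) by rewrite cl_sub ?perp_flat // sub_perp_perp.
exact: subset_trans (sub_perp_perp _) (perpS h).
Qed.

(* A polar hyperplane [R x] meets every line, so it cuts the rank of a flat by at most
   one. *)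
Lemma rk_perpU1 x X : rk M (perp X) <= (rk M (perp (x |: X))).+1.
Proof.
have [_ _ _ meetR] := polR.
have eK : perp (x |: X) = perp X :&: [set y | R x y].
  apply/setP=> y; rewrite in_setI [y \in [set _ | _]]inE; apply/perpP/andP.
    by move=> h; split; [apply/perpP=> z zX|]; apply: h; rewrite !inE ?zX ?eqxx ?orbT.
  by case=> /perpP h Rxy z /setU1P[->|/h].
have [sub|/subsetPn[y yX yK]] := boolP (perp X \subset perp (x |: X)).
  by apply: leqW; apply: rkS.
apply: (@leq_trans (rk M (y |: perp (x |: X)))); last first.
  by rewrite rkU1 -addn1 leq_add2l leq_b1.
rewrite -(rk_cl M (y |: _)); apply: rkS; apply/subsetP=> z zX.
have [->|nzy] := eqVneq z y; first by rewrite mem_cl // !inE eqxx.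
have nyz : y != z by rewrite eq_sym.
have [k kl Rk] := meetR x y z (in_setT _) (in_setT _) (in_setT _) nyz.
have kK : k \in perp (x |: X).
  by rewrite eK in_setI [k \in [set _ | _]]inE Rk (line_in (perp_flat X) yX zX kl).
have nky : k != y by apply: contraNneq yK => <-.
apply: (line_in (cl_flat M _) _ _ (line_rot simpleM kl nky)); apply: mem_cl.
  by rewrite !inE eqxx.
by apply/setU1P; right.
Qed.

Lemma rk_perpU X Z : rk M (perp X) <= rk M (perp (X :|: Z)) + #|Z|.
Proof.
have [n le_n] := ubnP #|Z|; elim: n Z le_n => // n IH Z le_n.
have [->|[z zZ]] := set_0Vmem Z; first by rewrite setU0 leq_addr.
have cZ := cardsD1 z Z; rewrite zZ in cZ.
apply: leq_trans (IH (Z :\ z) _) _; first by move: le_n; rewrite cZ.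
have -> : X :|: Z = z |: (X :|: Z :\ z) by rewrite setUCA setD1K.
by rewrite cZ addnA leq_add2r addn1 rk_perpU1.
Qed.

Lemma perp_basis (B X : {set T}) : B \subset X -> indep M B -> #|B| = rk M X -> perp B = perp X.
Proof.
move=> sBX iB eB; apply/eqP.
rewrite eqEsubset [perp X \subset _]perpS // andbT -(perp_cl B) perpS //.
by rewrite rk_le_sub_cl // -eB rk_ge.
Qed.

(** With [B] a basis of [X], imposing its points one by one on the whole space gives the lower
    bound. Extending [B] to a basis of [M] brings the polar down to the empty set, which gives the
    upper bound. *)
Lemma rk_perp X : rk M (perp X) + rk M X = mrank M.
Proof.
have rk0 : rk M set0 = 0 by apply/eqP; have := rk_card M set0; rewrite cards0 leqn0.
have [B [sBX iB eB]] := rk_basis M X.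
have [K [sBK _ iK eK]] := indep_extend (subsetT B) iB.
rewrite -(perp_basis sBX iB eB) -eB; apply/eqP; rewrite eqn_leq; apply/andP; split.
  have eBK : B :|: K :\: B = K.
    by rewrite -{1}(setIidPr sBK) setID.
  have := rk_perpU B (K :\: B); rewrite eBK.
  rewrite (perp_basis (subsetT K) iK eK) perp_setT rk0 add0n cardsD (setIidPr sBK).
  by rewrite eK -/(mrank M); have := subset_leq_card sBK; rewrite eK -/(mrank M); lia.
have := rk_perpU set0 B; rewrite set0U; apply: leq_trans.
by apply/rkS/subsetP=> y _; apply/perpP=> x; rewrite inE.
Qed.

Lemma perpK X : is_flat M X -> perp (perp X) = X.
Proof.
move=> fX; apply/eqP; rewrite eqEsubset sub_perp_perp andbT.
rewrite -{2}(eqP fX) rk_le_sub_cl ?sub_perp_perp //.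
by have := rk_perp X; have := rk_perp (perp X); lia.
Qed.

Lemma self_adjoint : is_adjoint M M.
Proof.
split=> //; pose phi (X : flat M) : flat M := Flat (perp_flat X).
have phiK : involutive phi by move=> X; apply/val_inj/perpK/flatP.
have phiA (X Y : flat M) : (X <= Y)%O -> (phi Y <= phi X)%O by rewrite !flat_leE; apply: perpS.
have phiE (X Y : flat M) : (phi Y <= phi X)%O = (X <= Y)%O.
  by apply/idP/idP=> /phiA //; rewrite !phiK.
have phiL (X Y : flat M) : (phi Y < phi X)%O = (X < Y)%O.
  by rewrite !Order.POrderTheory.lt_leAnge !phiE.
have phi_top : phi \top%O = \bot%O.
  apply/val_inj; rewrite /= perp_setT; apply/eqP.
  by rewrite eq_sym -subset0 -perp_setT cl_sub ?perp_flat ?sub0set.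
exists phi; split=> //; first exact: inv_inj.
have phi_cov (X : flat M) : covers X \top%O = covers \bot%O (phi X).
  rewrite /covers -phi_top phiL; congr (_ && _).
  apply/forallP/forallP=> h Z; first by rewrite -(phiK Z) !phiL andbC; apply: h.
  by have := h (phi Z); rewrite !phiL andbC.
apply/setP=> Y; apply/imsetP/idP=> [[X]|]; rewrite !inE; first by rewrite phi_cov => h ->.
by move=> h; exists (phi Y); rewrite ?inE ?phi_cov phiK.
Qed.
End Duality.

(** * Self-adjoint matroids are modular *)

Section SelfAdjoint.
Variables (T : finType) (M : matroid T) (psi : flat M -> flat M).
Hypotheses (psi_inj : injective psi)
  (psi_anti : forall X Y : flat M, (X <= Y)%O -> (psi Y <= psi X)%O).
Implicit Types X Y : flat M.

(* [psi] acts injectively on the finite set of comparable pairs, hence bijectively. *)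
Lemma psi_le X Y : (psi Y <= psi X)%O = (X <= Y)%O.
Proof.
apply/idP/idP; last exact: psi_anti.
pose S := [set p : flat M * flat M | (p.1 <= p.2)%O].
pose h (p : flat M * flat M) := (psi p.2, psi p.1).
have inj_h : injective h by move=> [a b] [c d] [/psi_inj-> /psi_inj->].
have hS : h @: S = S.
  apply/eqP; rewrite eqEcard card_imset // leqnn andbT.
  by apply/subsetP=> _ /imsetP[p pS ->]; move: pS; rewrite !inE; apply: psi_anti.
move=> le; have : (psi Y, psi X) \in S by rewrite inE.
by rewrite -hS => /imsetP[[a b]]; rewrite inE => ab [/psi_inj-> /psi_inj->].
Qed.

Lemma flat_rk_lt X Y : (X < Y)%O -> rk M X < rk M Y.
Proof.
rewrite lt_leAnge !flat_leE => /andP[sXY nYX].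
rewrite ltnNge; apply: contra nYX => le.
by rewrite -[flat_set X](eqP (flatP X)) rk_le_sub_cl.
Qed.

(** Climbing from [X] to [Y] one rank at a time, each step strictly lowers the rank of the image. *)
Lemma rk_psi_chain X Y : (X <= Y)%O ->
  rk M (psi Y) + rk M Y <= rk M (psi X) + rk M X.
Proof.
have [n le_n] := ubnP (rk M Y - rk M X); elim: n X le_n => // n IH X le_n sXY.
have [->//|nXY] := eqVneq X Y.
have ltXY : (X < Y)%O by rewrite lt_neqAle nXY.
have /subsetPn[y yY yX] : ~~ (Y \subset X).
  by move: ltXY; rewrite lt_leAnge => /andP[].
pose X' : flat M := Flat (cl_flat M (y |: X)).
have rX' : rk M X' = (rk M X).+1 by rewrite /= rk_cl rkU1 (eqP (flatP X)) yX addn1.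
have sX'Y : (X' <= Y)%O.
  by rewrite flat_leE /= cl_sub ?(flatP Y) // subUset sub1set yY.
have sXX' : (X <= X')%O.
  by rewrite flat_leE /=; apply: subset_trans (sub_cl _ _); apply: subsetUr.
have ltXX' : (X < X')%O.
  rewrite lt_neqAle sXX' andbT.
  by apply/eqP=> e; move: rX'; rewrite -e; lia.
have ltp : (psi X' < psi X)%O.
  by move: ltXX'; rewrite !lt_leAnge !psi_le.
have rp := flat_rk_lt ltp; have rXY := flat_rk_lt ltXY.
have h : rk M Y - rk M X' < n by rewrite rX'; lia.
by have := IH X' h sX'Y; rewrite rX'; lia.
Qed.

(** The chain bound from the bottom to [X] and from [X] to the top squeezes the sum, since the image
    of the bottom has rank at most [mrank M]. *)
Lemma rk_psi X : rk M (psi X) + rk M X = mrank M.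
Proof.
have := @rk_psi_chain X \top%O (lex1 X).
have := @rk_psi_chain \bot%O X (le0x X).
rewrite flat_botE flat_topE rk_cl -/(mrank M).
have r0 := rk_card M set0; rewrite cards0 in r0.
have : rk M (psi \bot%O) <= mrank M by apply/rkS/subsetT.
lia.
Qed.

Lemma antitone_modular : modular M.
Proof.
move=> X Y.
have up := rk_submodular M X Y.
have low := rk_submodular M (psi X) (psi Y).
rewrite -(rk_cl M (X :|: Y)) -flat_meetE -flat_joinE in up.
rewrite -(rk_cl M (psi X :|: psi Y)) -flat_meetE -flat_joinE in low.
(* Preimages under [psi] show that it exchanges meets and joins, so submodularity at the images is
   supermodularity at [X] and [Y]. *)
have [psi' psiK psi'K] := injF_bij psi_inj.
have eM : (psi X `&` psi Y)%O = psi (X `|` Y)%O.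
  apply: le_anti; apply/andP; split; last first.
    rewrite lexI !psi_le.
    by rewrite leUl leUr.
  have eZ := psi'K (psi X `&` psi Y)%O.
  by rewrite -eZ psi_le leUx -(psi_le X) -(psi_le Y) eZ leIl leIr.
have eJ : (psi X `|` psi Y)%O = psi (X `&` Y)%O.
  apply: le_anti; apply/andP; split.
    rewrite leUx !psi_le.
    by rewrite leIl leIr.
  have eZ := psi'K (psi X `|` psi Y)%O.
  by rewrite -eZ psi_le lexI -(psi_le _ X) -(psi_le _ Y) eZ leUl leUr.
rewrite eM eJ in low.
move: up low (rk_psi X) (rk_psi Y) (rk_psi (X `&` Y)%O) (rk_psi (X `|` Y)%O).
move: (rk M (psi _)) (rk M (psi _)) (rk M (psi X)) (rk M (psi Y)) => a b c d.
by move: (rk M _) (rk M _) (rk M X) (rk M Y) (mrank M) => e f g h m; clear; lia.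
Qed.
End SelfAdjoint.

Section Isomorphism.
Variables (S T : finType) (N : matroid S) (M : matroid T) (f : S -> T).
Hypotheses (bij_f : bijective f) (f_indep : forall I : {set S}, indep M (f @: I) = indep N I).
Implicit Types X : {set S}.

Lemma iso_rk X : rk M (f @: X) = rk N X.
Proof.
have inj_f := bij_inj bij_f; apply/eqP; rewrite eqn_leq; apply/andP; split.
  have [J [sJ iJ <-]] := rk_basis M (f @: X).
  have eJ : f @: (f @^-1: J) = J.
    apply/setP=> y; apply/imsetP/idP => [[x]|yJ]; first by rewrite inE => ? ->.
    by have /imsetP[x _ ey] := subsetP sJ y yJ; exists x => //; rewrite inE -ey.
  rewrite -{1}eJ card_imset // rk_ge // -?f_indep ?eJ //.
  apply/subsetP=> x; rewrite inE => /(subsetP sJ)/imsetP[z zX /inj_f->] //.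
have [I [sI iI <-]] := rk_basis N X.
by rewrite -(card_imset _ inj_f) rk_ge ?f_indep // imsetS.
Qed.

Lemma iso_flat X : is_flat N X -> is_flat M (f @: X).
Proof.
move=> /eqP fX; have [g fK gK] := bij_f.
rewrite /is_flat eqEsubset sub_cl andbT; apply/subsetP=> y.
rewrite inE -(gK y) -imsetU1 !iso_rk => h; apply: imset_f.
by rewrite -fX inE.
Qed.
End Isomorphism.

Lemma adjoint_iso_modular (S T : finType) (N : matroid S) (M : matroid T) :
  is_adjoint N M -> isomorphic N M -> modular M.
Proof.
move=> [_ [phi [phi_inj phi_anti _]]] [f bij_f f_indep].
pose g (X : flat N) : flat M := Flat (iso_flat bij_f f_indep (flatP X)).
apply: (@antitone_modular T M (g \o phi)).
  apply: inj_comp phi_inj => X Y [] /(imset_inj (bij_inj bij_f)) e.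
  exact: val_inj.
by move=> X Y /phi_anti; rewrite !flat_leE /=; apply: imsetS.
Qed.

Lemma isomorphic_refl (T : finType) (M : matroid T) : isomorphic M M.
Proof. by exists id => [|I]; [exists id | rewrite imset_id]. Qed.

Theorem theorem4p8 (T : finType) (M : matroid T) (hsimple : simple_matroid M)
    (hcomp : forall C : {set T}, C \in components M -> rk M C <> 3) :
  modular M <->
  exists (S : finType) (adM : matroid S),
    is_adjoint adM M /\ isomorphic adM M.
Proof.
split=> [modularM|[S [N [adjN isoN]]]]; last exact: adjoint_iso_modular adjN isoN.
have [R polR] := modular_polarity hsimple modularM hcomp.
exists T, M; split; last exact: isomorphic_refl.
exact: (self_adjoint hsimple modularM polR).
Qed.
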